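(* Let $n\geqslant2$ and $p\geqslant1$. There exist a measurable function $Q:\mathbb{B}^n\to[1,\infty]$ with $Q\in L^p(\mathbb{B}^n)$ and homeomorphisms $g_m:\mathbb{B}^n\setminus\{0\}\to\mathbb{R}^n$ (onto their images), $m=1,2,\ldots$, each of which is a ring $Q$-mapping at $0$ and has a continuous extension to $0$, such that the family $\{g_m\}_{m=1}^\infty$ is not equicontinuous at $0$.
   Context: $\mathbb{B}^n$ is the open unit ball of $\mathbb{R}^n$, with Euclidean metric and Lebesgue measure $m$. For a family $\Gamma$ of curves in $\mathbb{R}^n$, a Borel $\rho\geqslant0$ is admissible if $\int_\gamma\rho\,ds\geqslant1$ for each locally rectifiable $\gamma\in\Gamma$, and $M_n(\Gamma)=\inf_\rho\int_{\mathbb{R}^n}\rho^n\,dm$. $\Gamma(E,F,H)$ is the family of continuous curves $\gamma:[0,1]\to\mathbb{R}^n$ with $\gamma(0)\in E$, $\gamma(1)\in F$, $\gamma(t)\in H$ for $t\in(0,1)$; $S(0,r)=\{|x|=r\}$, $A(0,r_1,r_2)=\{r_1<|x|<r_2\}$. A mapping $g:G\to\mathbb{R}^n$, $G=\mathbb{B}^n\setminus\{0\}$, is a ring $Q$-mapping at $0$ if for all $0<r_1<r_2<\infty$ and every Lebesgue measurable $\eta:(r_1,r_2)\to[0,\infty]$ with $\int_{r_1}^{r_2}\eta\,dr\geqslant1$: $M_n(g(\Gamma(S(0,r_1),S(0,r_2),A(0,r_1,r_2))))\leqslant\int_{A(0,r_1,r_2)\cap G}Q(x)\eta^n(|x|)\,dm(x)$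 (only curves lying in $G$ are mapped). A family of maps (extended continuously to $0$) is equicontinuous at $0$ if for every $\varepsilon>0$ there is $\delta>0$ such that $|g_m(x)-g_m(0)|<\varepsilon$ for all $m$ and all $x$ with $|x|<\delta$. *)

(* Defs.v *)
From HB Require Import structures.
From mathcomp Require Import all_boot all_order all_algebra.
From mathcomp Require Import all_classical all_reals all_analysis measurable_realfun.
Set Implicit Arguments. Unset Strict Implicit. Unset Printing Implicit Defensive.
Import Order.TTheory GRing.Theory Num.Theory.
Import numFieldNormedType.Exports.
Local Open Scope classical_set_scope.
Local Open Scope ring_scope.

Section Defs.
Context {R : realType}.
Variable n : nat.
Local Notation Rn := 'rV[R]_n.

Definition enorm (x : Rn) : R := Num.sqrt (\sum_(i < n) x ord0 i ^+ 2).

Definition unit_ball : set Rn := [set x | enorm x < 1].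
Definition punct_ball : set Rn := [set x | enorm x < 1 /\ x != 0].
Definition sphere (r : R) : set Rn := [set x | enorm x = r].
Definition annulus (r1 r2 : R) : set Rn := [set x | r1 < enorm x < r2].

(** Borel sets of R^n (the product topology of 'rV is the Euclidean one) *)
Definition Rn_borel : set (set Rn) := <<s [set U : set Rn | open U] >>.

Definition Rn_borel_fun (f : Rn -> \bar R) : Prop :=
  forall t : R, Rn_borel [set x | (f x < t%:E)%E].

(** Lebesgue integral of a nonnegative function over R^n, computed as the
    iterated (Tonelli) integral w.r.t. the (completed) 1-dim Lebesgue measure. *)
End Defs.
Arguments enorm {R n}.
Arguments unit_ball {R n}.
Arguments punct_ball {R n}.
Arguments sphere {R n}.
Arguments annulus {R n}.
Arguments Rn_borel {R n}.
Arguments Rn_borel_fun {R n}.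

Fixpoint intRn {R : realType} (n : nat) : ('rV[R]_n -> \bar R) -> \bar R :=
  match n with
  | 0 => fun f => f 0
  | k.+1 => fun f =>
      (\int[@completed_lebesgue_measure R]_t
         intRn (fun y : 'rV[R]_k => f (row_mx (\row_(j < 1) t) y)))%E
  end.

(** Lebesgue measurability of f : D -> [-oo,+oo] (D a subset of R): preimages of
    Borel sets of \bar R are Lebesgue (= Caratheodory for the Lebesgue outer
    measure, i.e. completed) measurable. *)
Definition leb_measurable_fun (R : realType) (D : set R) (f : R -> \bar R) : Prop :=
  forall B : set (\bar R), measurable B ->
    (@wlength R idfun)^*%mu.-cara.-measurable (D `&` f @^-1` B).

Section Defs2.
Context {R : realType}.
Variable n : nat.
Local Notation Rn := 'rV[R]_n.

Definition Rn_lebesgue_measurable (A : set Rn) : Prop :=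
  exists B1 B2 : set Rn, Rn_borel B1 /\ Rn_borel B2 /\ B1 `<=` A /\ A `<=` B2 /\
    intRn (fun x => (\1_(B2 `\` B1) x)%:E) = 0%E.

Definition polysum (gamma : R -> Rn) (pts : seq R) : R :=
  \sum_(pq <- zip pts (behead pts)) enorm (gamma pq.2 - gamma pq.1).

Definition curve_length (gamma : R -> Rn) (a b : R) : \bar R :=
  ereal_sup [set (polysum gamma (a :: rcons s b))%:E |
             s in [set s : seq R | sorted <=%R (a :: rcons s b)]].

Definition locally_rectifiable (gamma : R -> Rn) : Prop :=
  forall a b, 0 <= a -> a <= b -> b <= 1 -> (curve_length gamma a b < +oo)%E.

Definition arclen_param (gamma : R -> Rn) (s : R) : Rn :=
  gamma (inf [set t | 0 <= t <= 1 /\ (s%:E <= curve_length gamma 0 t)%E]).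

Definition line_integral (rho : Rn -> \bar R) (gamma : R -> Rn) : \bar R :=
  (\int[@completed_lebesgue_measure R]_(s in (`[0%R, fine (curve_length gamma 0 1)]%classic : set R))
     rho (arclen_param gamma s))%E.

Definition curve_family (E F H : set Rn) : set (R -> Rn) :=
  [set gamma | {within (`[0%R, 1%R]%classic : set R), continuous (gamma : R -> Rn)} /\ E (gamma 0) /\ F (gamma 1) /\
               (forall t, 0 < t < 1 -> H (gamma t))].

Definition admissible (Gam : set (R -> Rn)) (rho : Rn -> \bar R) : Prop :=
  Rn_borel_fun rho /\ (forall x, (0 <= rho x)%E) /\
  (forall gamma, Gam gamma -> locally_rectifiable gamma ->
     (1 <= line_integral rho gamma)%E).

Definition modulus (Gam : set (R -> Rn)) : \bar R :=
  ereal_inf [set intRn (fun x => (rho x ^+ n)%E) | rho in admissible Gam].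

Definition image_family (g : Rn -> Rn) (Gam : set (R -> Rn)) : set (R -> Rn) :=
  [set g \o gamma | gamma in [set gamma | Gam gamma /\
                       (forall t, 0 <= t <= 1 -> punct_ball (gamma t))]].

Definition ring_Q_mapping (Q : Rn -> \bar R) (g : Rn -> Rn) : Prop :=
  forall r1 r2 : R, 0 < r1 -> r1 < r2 ->
  forall eta : R -> \bar R,
    (forall r, r1 < r < r2 -> (0 <= eta r)%E) ->
    leb_measurable_fun `]r1, r2[%classic eta ->
    (1 <= \int[@completed_lebesgue_measure R]_(r in (`]r1, r2[%classic : set R)) eta r)%E ->
    (modulus (image_family g (curve_family (sphere r1) (sphere r2) (annulus r1 r2)))
     <= intRn (fun x => if x \in annulus r1 r2 `&` punct_ball
                        then Q x * (eta (enorm x)) ^+ n else 0))%E.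

Definition homeo_onto_image (D : set Rn) (g : Rn -> Rn) : Prop :=
  {within D, continuous g} /\ {in D &, injective g} /\
  exists h : Rn -> Rn, (forall x, D x -> h (g x) = x) /\
                       {within g @` D, continuous h}.

Definition cont_ext_at0 (g : Rn -> Rn) (c : Rn) : Prop :=
  forall e : R, 0 < e -> exists2 d : R, 0 < d &
    forall x, punct_ball x -> enorm x < d -> enorm (g x - c) < e.

Definition equicont_at0 (g : nat -> Rn -> Rn) (c : nat -> Rn) : Prop :=
  forall e : R, 0 < e -> exists2 d : R, 0 < d &
    forall m x, (x = 0 \/ punct_ball x) -> enorm x < d ->
      enorm ((if x == 0 then c m else g m x) - c m) < e.

End Defs2.

(* Main.v *)
Require Import Defs.
From HB Require Import structures.
From mathcomp Require Import all_boot all_order all_algebra.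
From mathcomp Require Import all_classical all_reals all_analysis.
From mathcomp Require Import measurable_realfun ring lra.
Import Order.TTheory GRing.Theory Num.Theory.
Import numFieldNormedType.Exports.
Local Open Scope classical_set_scope.
Local Open Scope ring_scope.

(** The maps are [g_m(x) = rho_m(s) x / |x|_oo] with [s = |x|^(1/K)] and
    [rho_m(s) = min((m+2) s, 1 + s)]: each of them tends to [0] at the origin, but
    the sphere [s = 1/(m+1)], which shrinks to the origin, is sent outside the
    unit cube.  Spheres go to boundaries of cubes, so an image ring is a cube
    shell [t1 <= |y|_oo <= t2], and the constant density [1/(t2-t1)] on it bounds
    the modulus by [n 4^n / (t2-t1)^(n-1)], where [t2-t1 >= s2-s1] because the
    slope of [rho_m] is at least [1].

    With [Q = 1 + C / s^(n-1)], slicing the iterated integral gives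
    [int Q eta(|x|)^n dx >= c_n C int (r/s)^(n-1) eta^n dr], and comparing [eta]
    with the extremal density [s/r] (Young's inequality) bounds this below by a
    multiple of [C / (s2-s1)^(n-1)] as soon as [int eta >= 1].  Both bounds have
    the same shape and only a large [C] is needed.  Finally [Q^p <= M |x|^(-1/2)]
    in the ball when [K >= 2 (n-1) p], hence [Q] is in [L^p]. *)

(** * Integrals of arbitrary nonnegative functions through simple functions *)

Section lower_integral.
Local Open Scope ereal_scope.
Import HBNNSimple.

(* The integral of a nonnegative function is a supremum over the simple functions
   below it, hence is monotone even on nonmeasurable functions. *)
Lemma le_integral_nomeas (d : measure_display) (T : measurableType d)
    (R : realType) (mu : {measure set T -> \bar R}) (D : set T)
    (f g : T -> \bar R) :
  (forall x, D x -> 0 <= f x) -> (forall x, D x -> f x <= g x) ->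
  \int[mu]_(x in D) f x <= \int[mu]_(x in D) g x.
Proof.
move=> f0 fg; rewrite !ge0_integralE//; last first.
  by move=> x Dx; exact: le_trans (f0 _ Dx) (fg _ Dx).
apply: ereal_sup_le => _ [h /= hf <-]; exists h => // x /=.
apply: le_trans (hf x) _; rewrite /patch; case: ifPn => //.
by rewrite inE => /fg.
Qed.

(** Both sums are taken over the union of the two ranges, where the level [0] contributes nothing.
    The two measurable spaces may differ, which allows comparing Borel with completed integrals, or
    integrals related by a change of variables. *)
Lemma le_sintegral_fibers (d1 d2 : measure_display) (T1 : measurableType d1)
    (T2 : measurableType d2) (R : realType)
    (mu1 : {measure set T1 -> \bar R}) (mu2 : {measure set T2 -> \bar R})
    (h1 : {nnsfun T1 >-> R}) (h2 : {nnsfun T2 >-> R}) :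
  (forall y : R, (0 < y)%R -> mu1 (h1 @^-1` [set y]) <= mu2 (h2 @^-1` [set y])) ->
  sintegral mu1 h1 <= sintegral mu2 h2.
Proof.
move=> H; rewrite !sintegralE.
rewrite (fsbig_widen _ (range h1 `|` range h2))//=; last first.
  by move=> x [_ /= /preimage10->]; rewrite measure0 mule0.
rewrite [leRHS](fsbig_widen _ (range h1 `|` range h2))//=; last first.
  by move=> x [_ /= /preimage10->]; rewrite measure0 mule0.
apply: lee_fsum => /=; first by rewrite finite_setU; split; exact: fimfunP.
move=> r; have [r0|] := ltP 0%R r; first by move=> _; rewrite lee_pmul2l ?H.
rewrite le_eqVlt => /orP[/eqP -> _|r0]; first by rewrite !mul0e.
by case=> -[x _ E]; move: r0; rewrite -E ltNge fun_ge0.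
Qed.

(** The zero fibre is the complement of the finitely many positive fibres, and every preimage is a
    finite union of fibres. This fits the previous lemma, which also looks at positive levels
    only. *)
Lemma nnsfun_of_fibers (d : measure_display) (T : measurableType d)
    (R : realType) (f : T -> R) :
  finite_set (range f) -> (forall x, 0 <= f x)%R ->
  (forall y, (0 < y)%R -> measurable (f @^-1` [set y])) ->
  exists h : {nnsfun T >-> R}, h = f :> (T -> R).
Proof.
move=> ff f0 mfp.
have mf y : measurable (f @^-1` [set y]).
  have [/mfp//|] := ltP 0%R y; rewrite le_eqVlt => /orP[/eqP ->|y0]; last first.
    rewrite preimage10// => -[x _ fx]; move: y0; rewrite -fx ltNge.
    by rewrite f0.
  rewrite (_ : f @^-1` _ =
      ~` \bigcup_(y in range f `&` [set r | 0 < r]%R) f @^-1` [set y]).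
    apply: measurableC; apply: fin_bigcup_measurable => [|z [_]]; last exact: mfp.
    exact: sub_finite_set ff.
  apply/seteqP; split => [x /= fx [z [_ /= z0 E]]|x /= H].
    by rewrite -E fx ltxx in z0.
  apply/eqP; rewrite eq_le f0 andbT leNgt; apply/negP => fx; apply: H.
  by exists (f x) => //; split => //; exists x.
have mmf : measurable_fun setT f.
  move=> _ B _; rewrite setTI.
  rewrite (_ : f @^-1` B = \bigcup_(y in range f `&` B) f @^-1` [set y]).
    apply: fin_bigcup_measurable => [|y _]; last exact: mf.
    exact: sub_finite_set ff.
  apply/seteqP; split => [x Bx|x [y [_ By] /= ->//]].
  by exists (f x) => //; split => //; exists x.
pose h1 := isMeasurableFun.Build _ _ _ _ f mmf.
pose h2 := FiniteImage.Build _ _ f ff.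
pose h3 := isNonNegFun.Build _ _ f f0.
pose h : {nnsfun T >-> R} := HB.pack f h1 h2 h3.
by exists h.
Qed.

End lower_integral.

(** * Passing from the completed Lebesgue measure to the Borel one *)

Section completed_integral.
Context {R : realType}.
Local Open Scope ereal_scope.
Import HBNNSimple.
Local Notation cmu := (@completed_lebesgue_measure R).
Local Notation mu := (@lebesgue_measure R).

(** Such a set is a Borel set together with a part of a Borel null set [N]; removing all of [N]
    leaves a Borel set. *)
Lemma cara_borel_core (E : set R) : (@wlength R idfun)^*%mu.-cara.-measurable E ->
  exists N : set (measurableTypeR R), [/\ measurable N, mu N = 0 &
    @measurable _ (measurableTypeR R) (E `\` N)].
Proof.
rewrite -completed_caratheodory_measurable g_sigma_completed_algebra_genE.
move=> [A /= mA [M [N [mN N0 MN]] <-]].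
exists N; split => //.
rewrite (_ : _ `\` _ = A `\` N); first exact: measurableD.
apply/seteqP; split => [x [[Ax|/MN//] Nx]|x [Ax Nx]]; split => //.
by left.
Qed.

(** A simple function for the completed measure becomes Borel when it is set to [0] on null sets;
    conversely a Borel simple function is already simple for the completed measure. Since [f] enters
    only as an upper bound, it is arbitrary. *)
Lemma ge0_integral_completed (f : R -> \bar R) : (forall x, 0 <= f x) ->
  \int[cmu]_x f x = \int[mu]_x f x.
Proof.
move=> f0; apply/eqP; rewrite eq_le; apply/andP; split.
- rewrite !ge0_integralTE//.
  apply: ge_ereal_sup => _ [h /= hf <-].
  have /choice[N_ /all_and3[mN N0 mhN]] y :
      exists N : set (measurableTypeR R), [/\ measurable N, mu N = 0 &
      @measurable _ (measurableTypeR R) (h @^-1` [set y] `\` N)].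
    by apply: cara_borel_core; exact: (measurable_funPTI h (measurable_set1 y)).
  (* Each value [y] has its own null set [N_ y], so a point is discarded only when it lies in the
     null set of its own value. *)
  pose h' x : R := if x \in N_ (h x) then 0%R else h x.
  have h'le x : (h' x <= h x)%R.
    by rewrite /h'; case: ifP => // _; exact: fun_ge0.
  have h'0 x : (0 <= h' x)%R.
    by rewrite /h'; case: ifP => // _; exact: fun_ge0.
  have h'E (y : R) : (0 < y)%R ->
      h' @^-1` [set y] = h @^-1` [set y] `\` N_ y.
    move=> y0; apply/seteqP; split => x; rewrite /h' /=.
    + case: ifPn => [_ E|]; first by rewrite -E ltxx in y0.
      by rewrite notin_setE => /[swap] <-.
    + by move=> [<- /= Nx]; case: ifPn => //; rewrite inE.
  have [|||k kE] := nnsfun_of_fibers _ (measurableTypeR R) R h'.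
  + apply: (@sub_finite_set _ _ (0%R |` range h)).
      move=> _ [x _ <-]; rewrite /h'; case: ifP => _; [by left|by right; exists x].
    by rewrite finite_setU; split => //; exact: fimfunP.
  + exact: h'0.
  + by move=> y y0; rewrite h'E.
  apply: (@le_trans _ _ (sintegral mu k)); last first.
    apply: ereal_sup_ubound; exists k => //= x.
    by rewrite kE (le_trans _ (hf x))// lee_fin.
  apply: le_sintegral_fibers => y y0; rewrite kE h'E//.
  rewrite -[leLHS]/(mu (h @^-1` [set y])).
  (* Subadditivity splits the fibre along [N_ y], and the piece inside [N_ y] has measure zero. *)
  apply: le_trans (le_outer_measureIC (@wlength R idfun)^*%mu (~` N_ y) _) _.
  rewrite setCK -setDE -[leRHS]adde0 leeD2l// -(N0 y).
  by apply: le_outer_measure; exact: subIsetr.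
- rewrite !ge0_integralTE//.
  apply: ge_ereal_sup => _ [h /= hf <-].
  have [||y _|k kE] := nnsfun_of_fibers _ (caratheodory_type (@wlength R idfun)^*%mu) R h.
  + exact: (@fimfunP _ _ h).
  + by move=> x; exact: (@fun_ge0 _ _ h).
  + apply: sub_caratheodory; exact: (measurable_funPTI h (measurable_set1 y)).
  apply: (@le_trans _ _ (sintegral cmu k)); last first.
    by apply: ereal_sup_ubound; exists k => //= x; rewrite kE.
  by apply: le_sintegral_fibers => y y0; rewrite kE.
Qed.

End completed_integral.

(** * The substitution [r = sqrt(a^2 + t^2)] as an inequality *)

Section contraction.
Context {R : realType}.
Local Open Scope ereal_scope.
Import HBNNSimple.
Local Notation mu := (@lebesgue_measure R).

(** An increasing contraction sends a cover of [A] by half-open intervals to a cover of the image by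
    intervals that are no longer; this is a statement about outer measure. *)
Lemma lebesgue_image_contraction (phi : R -> R) (A : set R) :
  (forall x y, 0 <= x -> x < y -> phi x < phi y)%R ->
  (forall x y, 0 <= x -> x < y -> phi y - phi x <= y - x)%R ->
  A `<=` `]0%R, +oo[ -> mu (phi @` A) <= mu A.
Proof.
move=> phi_incr phi_contr A0.
apply: le_ereal_inf_tmp => _ [F [mF AF] <-].
have /choice[b bE] k : exists b : R * R, F k = `]b.1, b.2]%classic.
  by have [b _ <-] := mF k; exists b.
(* The endpoints are clipped at [0], since [phi] is controlled on nonnegative arguments only. *)
pose c (k : nat) := (Num.max (b k).1 0, Num.max (b k).2 0)%R.
pose G k : set R := `]phi (c k).1, phi (c k).2]%classic.
apply: (@le_trans _ _ (\sum_(k <oo) wlength idfun (G k))).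
  apply: ereal_inf_lbound; exists G => //; split.
    by move=> k; exact: is_ocitv.
  move=> _ [t At <-]; have [k _ Fkt] := AF _ At; exists k => //.
  have := A0 _ At; rewrite /= !in_itv/= andbT => t0.
  move: Fkt; rewrite bE /= in_itv /= => /andP[t1 t2].
  have phi_le x y : (0 <= x -> x <= y -> phi x <= phi y)%R.
    by rewrite [(x <= y)%R]le_eqVlt => x0 /orP[/eqP ->//|/(phi_incr _ _ x0)/ltW].
  apply/andP; split; last by apply: phi_le; [exact: ltW|rewrite le_max t2].
  by apply: phi_incr; rewrite /c/= ?le_max ?lexx ?orbT// gt_max t1 t0.
apply: lee_nneseries => [k _ _|k _]; first exact: wlength_ge0.
have c0 : (0 <= (c k).1)%R /\ (0 <= (c k).2)%R by rewrite /c/= !le_max lexx !orbT.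
rewrite bE /G; have [b12|b12] := ltP (b k).1 (b k).2; last first.
  have : ((c k).2 <= (c k).1)%R by rewrite /c /= ge_max !le_max lexx orbT b12.
  rewrite le_eqVlt => /orP[/eqP ->|/(phi_incr _ _ c0.2)/ltW c21].
    by rewrite set_itv_ge ?bnd_simp ?ltxx// wlength0 wlength_ge0.
  by rewrite set_itv_ge ?bnd_simp -?leNgt// wlength0 wlength_ge0.
have : ((c k).1 <= (c k).2)%R by rewrite /c /= ge_max !le_max lexx orbT ltW.
rewrite le_eqVlt => /orP[/eqP ->|c12].
  by rewrite set_itv_ge ?bnd_simp ?ltxx// wlength0 wlength_ge0.
have := phi_incr _ _ c0.1 c12; have := phi_contr _ _ c0.1 c12 => h1 h2.
have e2 := @wlength_itv_bnd R idfun _ _ false false (ltW b12).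
rewrite wlength_itv_bnd ?(ltW h2)// -[leRHS]/(wlength idfun `](b k).1, (b k).2]%classic).
rewrite [leRHS]e2 lee_fin /=.
apply: (le_trans h1); rewrite /c/=.
by case: (leP (b k).1 0%R); case: (leP (b k).2 0%R); lra.
Qed.

(** The substitution map is an increasing contraction of the half-line, so pulling a simple minorant
    of [F] back along it can only enlarge the positive fibres. *)
Lemma integral_hypot_ge (F : R -> \bar R) (a : R) :
  (0 <= a)%R -> (forall x, 0 <= F x) ->
  \int[mu]_(r in `]a, +oo[) F r <=
  \int[mu]_(t in `]0%R, +oo[) F (Num.sqrt (a ^+ 2 + t ^+ 2)).
Proof.
move=> a0 F0.
pose phi (t : R) := Num.sqrt (a ^+ 2 + t ^+ 2).
have phi_incr x y : (0 <= x -> x < y -> phi x < phi y)%R.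
  move=> x0 xy; rewrite /phi ltr_sqrt; first nra. nra.
have phi_contr x y : (0 <= x -> x < y -> phi y - phi x <= y - x)%R.
  move=> x0 xy; rewrite lerBlDr -[leRHS]ger0_norm; last first.
    by rewrite addr_ge0 ?sqrtr_ge0// subr_ge0 ltW.
  rewrite -sqrtr_sqr /phi; apply: ler_wsqrtr.
  have S0 : (0 <= a ^+ 2 + x ^+ 2)%R by rewrite addr_ge0 ?sqr_ge0.
  (* With [q = sqrt(a^2 + x^2)], the bound [x <= q] yields [(q + y - x)^2 >= a^2 + y^2], which is
     the contraction property squared. *)
  have xs : (x <= Num.sqrt (a ^+ 2 + x ^+ 2))%R.
    rewrite -{1}(ger0_norm x0) -sqrtr_sqr; apply: ler_wsqrtr.
    by rewrite lerDr sqr_ge0.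
  have := sqr_sqrtr S0; set q := Num.sqrt _ in xs * => qE; nra.
rewrite !ge0_integralE//.
apply: ge_ereal_sup => _ [h /= hF <-].
pose k x : R := if (0 < x)%R then h (phi x) else 0%R.
have kE y : (0 < y)%R -> k @^-1` [set y] = `]0%R, +oo[ `&` phi @^-1` (h @^-1` [set y]).
  move=> y0; apply/seteqP; split=> x; rewrite /k /= in_itv/= andbT.
    by case: ifPn => // _ E; rewrite -E ltxx in y0.
  by move=> [-> ->].
have [|||l lE] := nnsfun_of_fibers _ (measurableTypeR R) R k.
- apply: (@sub_finite_set _ _ (0%R |` range h)).
    move=> _ [x _ <-]; rewrite /k; case: ifP => _; [by right; exists (phi x)|by left].
  by rewrite finite_setU; split => //; exact: fimfunP.
- by move=> x; rewrite /k; case: ifP => // _; exact: fun_ge0.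
- move=> y y0; rewrite kE//; apply: measurableI => //.
  rewrite -[X in measurable X]setTI; apply: (_ : measurable_fun setT phi) => //.
    apply: continuous_measurable_fun => x.
    apply: continuous_comp; last exact: sqrt_continuous.
    by apply: cvgD; [exact: cvg_cst|exact: exprn_continuous].
  exact: (measurable_funPTI h (measurable_set1 y)).
apply: (@le_trans _ _ (sintegral mu l)); last first.
  apply: ereal_sup_ubound; exists l => //= x.
  rewrite lE /k /patch mem_setE in_itv/= andbT; case: ifPn => // _.
  apply: le_trans (hF _) _; rewrite /patch; case: ifPn => // _.
apply: le_sintegral_fibers => y y0; rewrite lE kE//.
apply: le_trans (lebesgue_image_contraction phi _ phi_incr phi_contr _).
  (* A positive value of [h] at [r] forces [a < r], hence [r] is the image of
     [sqrt(r^2 - a^2) > 0]. *)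
  apply: le_outer_measure => r hr.
  have ra : (a < r)%R.
    have := hF r; rewrite /patch mem_setE in_itv/= andbT; case: ifPn => // _.
    by rewrite hr lee_fin leNgt y0.
  have d0 : (0 < r ^+ 2 - a ^+ 2)%R by nra.
  have pE : phi (Num.sqrt (r ^+ 2 - a ^+ 2)) = r.
    rewrite /phi sqr_sqrtr ?(ltW d0)// addrC subrK sqrtr_sqr ger0_norm//.
    exact: ltW (le_lt_trans a0 ra).
  exists (Num.sqrt (r ^+ 2 - a ^+ 2)) => //=; rewrite pE; split => //.
  by rewrite in_itv/= andbT sqrtr_gt0.
by move=> x [].
Qed.

End contraction.

(** * Lower bounds for iterated integrals of radial functions *)

Section iterated.
Context {R : realType}.
Local Open Scope ereal_scope.
Local Notation mu := (@lebesgue_measure R).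

Lemma intRn_ge0 (n : nat) (f : 'rV[R]_n -> \bar R) :
  (forall x, 0 <= f x) -> 0 <= intRn f.
Proof. by elim: n f => [|n IH] f f0 //=; apply: integral_ge0 => t _; exact: IH. Qed.

Lemma le_intRn (n : nat) (f g : 'rV[R]_n -> \bar R) :
  (forall x, 0 <= f x) -> (forall x, f x <= g x) -> intRn f <= intRn g.
Proof.
elim: n f g => [|n IH] f g f0 fg //=.
by apply: le_integral_nomeas => [t _|t _]; [exact: intRn_ge0|exact: IH].
Qed.

(** Peels off one coordinate with the plain Lebesgue measure, for which the substitution above and
    Tonelli's theorem are stated. *)
Lemma intRnS (n : nat) (f : 'rV[R]_n.+1 -> \bar R) : (forall x, 0 <= f x) ->
  intRn f = \int[mu]_t intRn (fun y : 'rV_n => f (row_mx (\row_(j < 1) t) y)).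
Proof.
move=> f0; rewrite -ge0_integral_completed// => t; exact: intRn_ge0.
Qed.

Local Arguments intRn : simpl never.

Lemma enorm_ge0 (n : nat) (x : 'rV[R]_n) : (0 <= enorm x)%R.
Proof. exact: sqrtr_ge0. Qed.

Lemma sqr_enorm (n : nat) (x : 'rV[R]_n) :
  (enorm x ^+ 2 = \sum_(i < n) x ord0 i ^+ 2)%R.
Proof. by rewrite sqr_sqrtr// sumr_ge0// => i _; exact: sqr_ge0. Qed.

Lemma sqr_enorm_row_mx (n : nat) (t : R) (y : 'rV[R]_n) :
  (enorm (row_mx (\row_(j < 1) t) y : 'rV_n.+1) ^+ 2 = t ^+ 2 + enorm y ^+ 2)%R.
Proof.
rewrite !sqr_enorm (@big_split_ord _ _ _ 1 n) big_ord1.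
congr (_ + _)%R; first by rewrite (@row_mxEl _ 1 1 n) mxE.
by apply: eq_bigr => i _; rewrite (@row_mxEr _ 1 1 n).
Qed.

(** Induction on [k]: restricting the first coordinate [t] to [[0, u]] gives one factor [u] and
    replaces [a] by [sqrt(a^2 + t^2)], whose square is at most [a^2 + u^2]. The last coordinate is
    handled by the substitution [integral_hypot_ge]. *)
Lemma intRn_radial_slab_ge (k : nat) (F : R -> \bar R) (a u : R) :
  (forall r, 0 <= F r) -> (0 <= a)%R -> (0 <= u)%R ->
  (u ^+ k)%:E * \int[mu]_(r in `]Num.sqrt (a ^+ 2 + k%:R * u ^+ 2), +oo[) F r <=
  intRn (fun y : 'rV[R]_k.+1 => F (Num.sqrt (a ^+ 2 + enorm y ^+ 2))).
Proof.
move=> F0 + u0; elim: k a => [|k IH] a a0.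
  rewrite expr0 mul1e mul0r addr0 sqrtr_sqr ger0_norm// intRnS//=.
  apply: (le_trans (integral_hypot_ge F a a0 F0)).
  rewrite integral_mkcond; apply: le_integral_nomeas => t _.
    by rewrite /patch; case: ifP.
  rewrite -[leRHS]/(F _) sqr_enorm_row_mx sqr_enorm big_ord0 addr0 /patch; case: ifP => //.
rewrite intRnS//.
set J := (\int[_]_(_ in _) _).
have J0 : 0 <= J by apply: integral_ge0.
apply: (@le_trans _ _ (\int[mu]_(t in `[0%R, u]) ((u ^+ k)%:E * J))).
  rewrite integral_cst//= lebesgue_measure_itv/= lte_fin.
  have [->|un0] := eqVneq u 0%R; first by rewrite ltxx expr0n/= mul0e mule0.
  by rewrite lt_neqAle eq_sym un0 u0/= sube0 exprSr EFinM [leRHS]muleAC.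
rewrite integral_mkcond; apply: le_integral_nomeas => t _.
  by rewrite /patch; case: ifP => // _; rewrite mule_ge0// lee_fin exprn_ge0.
rewrite /patch; case: ifP => [|_]; last by apply: intRn_ge0.
rewrite mem_setE in_itv/= => /andP[t0 tu].
have S0 : (0 <= a ^+ 2 + t ^+ 2)%R by rewrite addr_ge0 ?sqr_ge0.
apply: (@le_trans _ _ (intRn (fun y : 'rV_k.+1 =>
    F (Num.sqrt (Num.sqrt (a ^+ 2 + t ^+ 2) ^+ 2 + enorm y ^+ 2))))); last first.
  by apply: le_intRn => // y; rewrite sqr_enorm_row_mx addrA (sqr_sqrtr S0).
apply: le_trans (IH (Num.sqrt (a ^+ 2 + t ^+ 2)) (sqrtr_ge0 _)).
apply: lee_pmul => //; first by rewrite lee_fin exprn_ge0.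
rewrite /J integral_mkcond [leRHS]integral_mkcond.
apply: le_integral_nomeas => r _; rewrite /patch; first by case: ifP.
case: ifP => [|_]; last by case: ifP.
rewrite !mem_setE !in_itv/= !andbT => Hr; rewrite ifT//.
apply: le_lt_trans Hr; apply: ler_wsqrtr; rewrite sqr_sqrtr//.
by rewrite -addrA lerD2l -natr1 mulrDl mul1r addrC lerD2l ler_sqr ?nnegrE.
Qed.

(* The fibre over the first coordinate u is bounded below on the slab of points
   whose remaining coordinates but the last one lie in [0, u]; Tonelli then
   exchanges u and the radius. *)
Lemma intRn_radial_ge (k : nat) (F : R -> \bar R) :
  (forall r, 0 <= F r) -> measurable_fun [set: measurableTypeR R] F ->
  \int[mu]_(r in `]0%R, +oo[) (((r / (2 * k.+1%:R)) ^+ k.+1)%:E * F r) <=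
  intRn (fun x : 'rV[R]_k.+2 => F (enorm x)).
Proof.
move=> F0 mF; set d : R := k.+1%:R.
have d0 : (0 < d)%R by rewrite ltr0n.
(* The range of [u] has length [r / (2 * d)], which supplies the missing power of [r]. Its lower end
   gives [(r / (2 * d))^k <= u^k], and its upper end puts [r] beyond the threshold
   [sqrt(u^2 + k u^2)] of the slab bound. *)
pose A (u r : R) : bool := [&& (0 < r)%R, (r / (2 * d) < u)%R & (u < r / d)%R].
pose G (z : R * R) : \bar R :=
  (if A z.1 z.2 then (z.2 / (2 * d)) ^+ k else 0)%:E * F z.2.
have G0 z : 0 <= G z.
  rewrite /G mule_ge0// lee_fin; case: ifPn => // /and3P[r0 _ _].
  by rewrite exprn_ge0// divr_ge0 ?ltW// mulr_gt0.
have mG : measurable_fun [set: measurableTypeR R * measurableTypeR R] G.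
  apply: emeasurable_funM; last exact: measurableT_comp mF measurable_snd.
  apply/measurable_EFinP; apply: measurable_fun_ifT => //=.
    apply: measurable_and.
      by apply: measurable_fun_ltr => //; exact: measurable_snd.
    apply: measurable_and; apply: measurable_fun_ltr => //.
    - by apply: measurable_funM => //; exact: measurable_snd.
    - by apply: measurable_funM => //; exact: measurable_snd.
  apply: measurable_funX; apply: measurable_funM => //; exact: measurable_snd.
apply: (@le_trans _ _ (\int[mu]_r \int[mu]_u G (u, r))).
  rewrite integral_mkcond; apply: le_integral_nomeas => r _.
    rewrite /patch; case: ifPn => //.
    rewrite mem_setE in_itv/= andbT => r0; rewrite mule_ge0// lee_fin.
    by rewrite exprn_ge0// divr_ge0 ?ltW// mulr_gt0.
  rewrite /patch; case: ifPn => [|_]; last exact: integral_ge0.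
  rewrite mem_setE in_itv/= andbT => r0.
  apply: (@le_trans _ _ (\int[mu]_(u in `](r / (2 * d))%R, (r / d)%R[)
      (((r / (2 * d)) ^+ k)%:E * F r))).
    rewrite integral_cst//= lebesgue_measure_itv/= lte_fin.
    have e : (r / d - r / (2 * d) = r / (2 * d))%R by field; rewrite gt_eqF.
    rewrite -subr_gt0 e divr_gt0 ?mulr_gt0// -EFinB e exprSr EFinM.
    by rewrite [leRHS]muleAC.
  rewrite integral_mkcond; apply: le_integral_nomeas => u _.
    rewrite /patch; case: ifPn => // _; rewrite mule_ge0// lee_fin.
    by rewrite exprn_ge0// divr_ge0 ?ltW// mulr_gt0.
  rewrite /patch; case: ifPn => // ; rewrite mem_setE in_itv/= => Hu.
  by rewrite /G /A/= r0 Hu.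
rewrite -(fubini_tonelli (m1 := mu) (m2 := mu) _ mG G0).
rewrite intRnS//.
apply: le_integral_nomeas => u _; first exact: integral_ge0.
have [u0|u0] := ltP 0%R u; last first.
  rewrite integral0_eq ?intRn_ge0// => r _; rewrite /G /A/= ifF ?mul0e//.
  apply/negP => /and3P[r0 ru _]; move: (lt_le_trans ru u0).
  by rewrite ltNge divr_ge0 ?ltW// mulr_gt0.
apply: (@le_trans _ _ (intRn (fun y : 'rV_k.+1 =>
    F (Num.sqrt (u ^+ 2 + enorm y ^+ 2))))); last first.
  by apply: le_intRn => // y; rewrite -sqr_enorm_row_mx sqrtr_sqr ger0_norm// enorm_ge0.
apply: le_trans (intRn_radial_slab_ge k F u u F0 (ltW u0) (ltW u0)).
rewrite -ge0_integralZl_EFin//; last 2 first.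
- exact: measurable_funTS.
- by rewrite exprn_ge0// ltW.
rewrite [leRHS]integral_mkcond.
apply: le_integral_nomeas => r _; first exact: G0.
rewrite /G /A /patch/=; case: ifPn => [/and3P[r0 ru ur]|_].
  rewrite ifT.
    apply: lee_pmul => //; first by rewrite lee_fin exprn_ge0// divr_ge0 ?ltW// mulr_gt0.
    by rewrite lee_fin lerXn2r ?nnegrE ?divr_ge0 ?ltW// mulr_gt0.
  rewrite mem_setE in_itv/= andbT.
  have du0 : (0 <= d * u)%R by rewrite mulr_ge0// ltW.
  (* The threshold equals [sqrt(d) * u], which is at most [d * u] because [d >= 1]. *)
  rewrite (@le_lt_trans _ _ (d * u)%R)//; last by rewrite mulrC -ltr_pdivlMr.
  rewrite -[leRHS](ger0_norm du0) -sqrtr_sqr; apply: ler_wsqrtr.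
  rewrite -{1}[(u ^+ 2)%R]mul1r -mulrDl nat1r exprMn ler_wpM2r ?sqr_ge0//.
  by rewrite expr2 ler_pMr ?ltr0n// ler1n.
rewrite mul0e; case: ifPn => // _.
by rewrite mule_ge0// lee_fin exprn_ge0// ltW.
Qed.

End iterated.

(** * A one-dimensional weighted energy inequality *)

Section energy.
Context {R : realType}.
Lemma powR_continuous_gt0 (g x : R) : 0 < x ->
  {for x, continuous (fun y : R => y `^ g)}.
Proof.
move=> x0; apply: differentiable_continuous; apply/derivable1_diffP.
by apply: derivable_powR; rewrite in_itv/= andbT.
Qed.

Local Open Scope ereal_scope.
Local Notation mu := (@lebesgue_measure R).

Lemma integral_powR (g a b : R) : (0 < g)%R -> (0 < a)%R -> (a < b)%R ->
  \int[mu]_(r in `]a, b[) (r `^ (g - 1))%:E = ((b `^ g - a `^ g) / g)%:E.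
Proof.
move=> g0 a0 ab.
rewrite -(@integral_itv_bndoo _ _ _ _ true false); last first.
  by apply: measurable_funTS; apply/measurable_EFinP; exact: measurable_powR.
have gE (r : R) : (g * r `^ (g - 1) * g^-1 = r `^ (g - 1))%R.
  by rewrite mulrAC divff ?mul1r// gt_eqF.
have pos r : r \in `[a, b]%R -> (0 < r)%R.
  by rewrite in_itv/= => /andP[/(lt_le_trans a0)].
have dF (r : R) : (0 < r)%R ->
    is_derive r 1%R (fun x : R => x `^ g * g^-1)%R (r `^ (g - 1))%R.
  move=> r0; have := is_derive1_powR g r0 => H.
  apply: is_derive_eq; rewrite -[RHS]gE /GRing.scale/=.
  by rewrite mulr0 add0r mulrC.
rewrite (continuous_FTC2 (F := fun x : R => (x `^ g * g^-1)%R))//.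
- by rewrite -EFinB -mulrBl.
- apply: derivable_within_continuous => r /pos r0.
  by apply: derivable_powR; rewrite in_itv/= andbT.
- have cF (r : R) : (0 < r)%R -> {for r, continuous (fun x : R => x `^ g * g^-1)%R}.
    move=> r0; apply: cvgMl; exact: powR_continuous_gt0.
  split.
  + move=> r rab; have r0 : (0 < r)%R by apply: pos; exact: subset_itv_oo_cc rab.
    by have [] := dF r r0.
  + by apply: cvg_at_right_filter; exact: cF.
  + by apply: cvg_at_left_filter; apply: cF; exact: lt_trans ab.
- move=> r rab; have r0 : (0 < r)%R by apply: pos; exact: subset_itv_oo_cc rab.
  by rewrite derive1E; have [_ ->] := dF r r0.
Qed.

(** Young's inequality without sharp constants: the product is at most the power [N.+1] of the
    larger factor. *)
Lemma weak_young (N : nat) (a b : R) : (0 <= a -> 0 <= b ->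
  a * b ^+ N <= a ^+ N.+1 + b ^+ N.+1)%R.
Proof.
move=> a0 b0; rewrite !exprS; have [ab|ab] := leP a b.
  by rewrite ler_wpDl ?mulr_ge0 ?exprn_ge0// ler_wpM2r ?exprn_ge0.
rewrite ler_wpDr ?mulr_ge0 ?exprn_ge0// ler_wpM2l// lerXn2r ?nnegrE//.
exact: ltW.
Qed.

(** Young's inequality is applied to [h] and [l * w], with [w = r^(g-1)] the reciprocal of the
    weight [r / r^g]. After division by [w^N] it reads [l^N h <= w^(-N) h^(N+1) + l^(N+1) w], and
    this is integrated. *)
Lemma weighted_energy_ge (N : nat) (g r1 r2 : R) (h : R -> R) :
  (0 < g)%R -> (0 < r1)%R -> (r1 < r2)%R -> (forall r, 0 <= h r)%R ->
  measurable_fun [set: measurableTypeR R] h ->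
  (3 / 4)%:E <= \int[mu]_(r in `]r1, r2[) (h r)%:E ->
  ((g / (2 * (r2 `^ g - r1 `^ g))) ^+ N / 4)%:E <=
  \int[mu]_(r in `]r1, r2[) ((r / r `^ g) ^+ N * h r ^+ N.+1)%:E.
Proof.
move=> g0 r10 r12 h0 mh Hh.
(* As [w] has integral [s / g], this [l] makes the error term integrate to exactly [l^N / 2]; the
   remainder is [3/4 - 1/2 = 1/4] of [l^N]. *)
set s := (r2 `^ g - r1 `^ g)%R; set l := (g / (2 * s))%R.
have s0 : (0 < s)%R.
  by rewrite subr_gt0 gt0_ltr_powR// nnegrE ltW// (lt_trans r10).
have l0 : (0 < l)%R by rewrite divr_gt0// mulr_gt0.
set I := (leRHS).
have I0 : 0 <= I.
  apply: integral_ge0 => r /=; rewrite in_itv/= => /andP[r1r _].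
  by rewrite lee_fin mulr_ge0 ?exprn_ge0// divr_ge0 ?powR_ge0// ltW// (lt_trans r10).
have mp (q : R) : measurable_fun [set: measurableTypeR R] (fun r : R => r `^ q)%R.
  exact: measurable_powR.
have H1 : \int[mu]_(r in `]r1, r2[) (l ^+ N.+1 * r `^ (g - 1))%:E = (l ^+ N / 2)%:E.
  under eq_integral do rewrite EFinM.
  rewrite ge0_integralZl_EFin//; last 3 first.
  - by move=> r _; rewrite lee_fin powR_ge0.
  - by apply: measurable_funTS; apply/measurable_EFinP; exact: mp.
  - by rewrite exprn_ge0// ltW.
  rewrite integral_powR// -EFinM; congr EFin.
  rewrite exprS /l -/s; field. rewrite !gt_eqF//.
have : (l ^+ N)%:E * (3 / 4)%:E <= I + (l ^+ N / 2)%:E.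
  apply: (@le_trans _ _ ((l ^+ N)%:E * \int[mu]_(r in `]r1, r2[) (h r)%:E)).
    by rewrite lee_wpmul2l// lee_fin exprn_ge0// ltW.
  have mI : measurable_fun `]r1, r2[
      (fun r : R => ((r / r `^ g) ^+ N * h r ^+ N.+1)%:E).
    apply: measurable_funTS; apply/measurable_EFinP; apply: measurable_funM.
      apply: measurable_funX; apply: measurable_funM => //.
      by under eq_fun do rewrite -powRN; exact: mp.
    exact: measurable_funX.
  rewrite -H1 /I -ge0_integralD//; last 3 first.
  - move=> r /=; rewrite in_itv/= => /andP[r1r _].
    rewrite lee_fin mulr_ge0 ?exprn_ge0// divr_ge0 ?powR_ge0// ltW//.
    exact: lt_trans r1r.
  - by move=> r _; rewrite lee_fin mulr_ge0 ?powR_ge0// exprn_ge0// ltW.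
  - apply: measurable_funTS; apply/measurable_EFinP; apply: measurable_funM => //.
  rewrite -ge0_integralZl_EFin//; last 3 first.
  - by move=> r _; rewrite lee_fin.
  - by apply: measurable_funTS; apply/measurable_EFinP.
  - by rewrite exprn_ge0// ltW.
  apply: le_integral_nomeas => r /=; rewrite in_itv/= => /andP[r1r _].
    by rewrite mule_ge0 ?lee_fin// exprn_ge0// ltW.
  have r0 : (0 < r)%R by exact: lt_trans r1r.
  rewrite -EFinM -EFinD lee_fin.
  rewrite (_ : r `^ (g - 1) = r `^ g / r)%R; last first.
    by rewrite powRB ?(gt_eqF r0) ?implybT// powRr1 ?(ltW r0).
  set w := (r `^ g / r)%R; have w0 : (0 < w)%R by rewrite divr_gt0// powR_gt0.
  rewrite -[(r / r `^ g)%R]invf_div -/w.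
  have v0 : (0 < w^-1 ^+ N)%R by rewrite exprn_gt0// invr_gt0.
  have /(ler_wpM2l (ltW v0)) H :=
    weak_young N (h r) (l * w) (h0 r) (mulr_ge0 (ltW l0) (ltW w0)).
  have ww : (w^-1 ^+ N * w ^+ N = 1)%R by rewrite -exprMn mulVf ?expr1n// gt_eqF.
  apply: le_trans (le_trans _ H) _.
    rewrite [((l * w) ^+ N)%R]exprMn; move: ww; set v := (w^-1 ^+ N)%R; set x := (w ^+ N)%R => ww.
    have -> : (v * (h r * (l ^+ N * x)) = l ^+ N * h r * (v * x))%R by ring.
    by rewrite ww mulr1.
  rewrite mulrDr lerD2l [((l * w) ^+ N.+1)%R]exprMn [(w ^+ N.+1)%R]exprSr; move: ww.
  set v := (w^-1 ^+ N)%R; set x := (w ^+ N)%R => ww.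
  have -> : (v * (l ^+ N.+1 * (x * w)) = l ^+ N.+1 * w * (v * x))%R by ring.
  by rewrite ww mulr1.
case: (I) I0 => [i||]; rewrite ?leey// => i0.
rewrite -EFinM -EFinD !lee_fin; lra.
Qed.

End energy.

(** * Lower bound for the weighted integral over a ring *)

Section ring_energy.
Context {R : realType}.
Local Open Scope ereal_scope.
Local Notation mu := (@lebesgue_measure R).
Import HBNNSimple.

Lemma le_expe2r (n : nat) (x y : \bar R) : 0 <= x -> x <= y -> x ^+ n <= y ^+ n.
Proof.
move=> x0 xy; elim: n => [|n IH]; first by rewrite !expe0.
by rewrite !expeS lee_pmul// expe_ge0.
Qed.

(** The strict inequality leaves room to replace [eta] by a finite Borel simple minorant, which
    makes the Tonelli argument available. *)
Lemma integral_gt_nnsfun (D : set R) (eta : R -> \bar R) (c : R) :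
  measurable (D : set (measurableTypeR R)) ->
  (forall r, D r -> 0 <= eta r) ->
  c%:E < \int[@completed_lebesgue_measure R]_(r in D) eta r ->
  exists h : {nnsfun measurableTypeR R >-> R},
    (forall r, D r -> (h r)%:E <= eta r) /\
    c%:E < \int[mu]_(r in D) (h r)%:E.
Proof.
move=> mD eta0; rewrite integral_mkcond ge0_integral_completed; last first.
  by move=> r; rewrite /patch; case: ifPn => // /[!inE] /eta0.
rewrite ge0_integralTE; last first.
  by move=> r; rewrite /patch; case: ifPn => // /[!inE] /eta0.
move=> /ereal_sup_gt[_ [h /= hle <-] ch]; exists h; split => [r Dr|].
  by have := hle r; rewrite /patch mem_set.
rewrite integral_nnsfun// (_ : h \_ D = h)//.
apply/funext => r; rewrite /patch; case: ifPn => // nD.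
have := hle r; rewrite /patch (negbTE nD) lee_fin => hr0.
by apply/eqP; rewrite eq_le hr0 fun_ge0.
Qed.

Lemma enorm0 (n : nat) : enorm (0 : 'rV[R]_n) = 0%R.
Proof. by rewrite /enorm big1 ?sqrtr0// => i _; rewrite mxE expr0n. Qed.

Lemma ring_energy_ge (k : nat) (g C r1 r2 : R) (Q : 'rV[R]_k.+2 -> \bar R)
    (eta : R -> \bar R) :
  (0 < g)%R -> (0 <= C)%R -> (0 < r1)%R -> (r1 < r2)%R -> (r2 <= 1)%R ->
  (forall x, (0 < enorm x)%R -> (C / (enorm x `^ g) ^+ k.+1)%:E <= Q x) ->
  (forall r, (r1 < r < r2)%R -> 0 <= eta r) ->
  1 <= \int[@completed_lebesgue_measure R]_(r in `]r1, r2[) eta r ->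
  (C * ((g / (4 * k.+1%:R * (r2 `^ g - r1 `^ g))) ^+ k.+1 / 4))%:E <=
  intRn (fun x : 'rV[R]_k.+2 => if x \in annulus r1 r2 `&` punct_ball
                      then Q x * eta (enorm x) ^+ k.+2 else 0).
Proof.
move=> g0 C0 r10 r12 r21 HQ eta0 eta1; set N := k.+1.
(* Any constant strictly between [1/2] and [1] would serve: below [1] to extract [h], above [1/2] to
   absorb the error term of the energy inequality. *)
have [|||h [heta hint]] := integral_gt_nnsfun (`]r1, r2[%classic) eta (3 / 4)%R.
- by [].
- by move=> r /=; rewrite in_itv/=; exact: eta0.
- by apply: lt_le_trans eta1; rewrite lte_fin; lra.
(* A radial Borel minorant of the integrand, cut off outside the ring; the factor [(r / (2 * N))^N]
   of the radial bound then combines with it into the weight [(r / r^g)^N]. *)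
pose F (r : R) : R := if (r1 < r < r2)%R then (C / (r `^ g) ^+ N * h r ^+ k.+2)%R else 0%R.
have F0 r : (0 <= F r)%R.
  rewrite /F; case: ifPn => // _.
  by rewrite mulr_ge0 ?exprn_ge0 ?fun_ge0// divr_ge0// exprn_ge0// powR_ge0.
have mh : measurable_fun [set: measurableTypeR R] h by exact: measurable_funPT.
have mp : measurable_fun [set: measurableTypeR R] (fun r : R => (r `^ g)^-1)%R.
  by under eq_fun do rewrite -powRN; exact: measurable_powR.
have mF : measurable_fun [set: measurableTypeR R] (EFin \o F).
  apply/measurable_EFinP; apply: measurable_fun_ifT => //.
    by apply: measurable_and; apply: measurable_fun_ltr.
  apply: measurable_funM; last exact: measurable_funX.
  apply: measurable_funM => //; under eq_fun do rewrite -exprVn.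
  exact: measurable_funX.
apply: (@le_trans _ _ (intRn (fun x : 'rV_k.+2 => (EFin \o F) (enorm x)))); last first.
  apply: le_intRn => x /=; first by rewrite lee_fin.
  rewrite /F; case: ifPn => [Hr|Hr].
    have e0 : (0 < enorm x)%R by case/andP: Hr => /(lt_trans r10).
    rewrite mem_set; last first.
      split => //; split; first by case/andP: Hr => _ /lt_le_trans; exact.
      by apply: contraTN e0 => /eqP ->; rewrite enorm0 ltxx.
    rewrite EFinM lee_pmul ?HQ//.
    - by rewrite lee_fin divr_ge0// exprn_ge0// powR_ge0.
    - by rewrite lee_fin exprn_ge0// fun_ge0.
    - rewrite EFin_expe le_expe2r ?lee_fin ?fun_ge0//.
      by apply: heta; rewrite /= in_itv.
  by rewrite memNset// => -[H _]; move: Hr; rewrite H.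
apply: le_trans (intRn_radial_ge k (EFin \o F) _ mF); last first.
  by move=> r; rewrite lee_fin.
apply: (@le_trans _ _ ((C / (2 * N%:R) ^+ N)%:E * \int[mu]_(r in `]r1, r2[)
   ((r / r `^ g) ^+ N * h r ^+ N.+1)%:E)).
  apply: (@le_trans _ _ ((C / (2 * N%:R) ^+ N)%:E *
      ((g / (2 * (r2 `^ g - r1 `^ g))) ^+ N / 4)%:E)).
    rewrite -EFinM lee_fin le_eqVlt; apply/orP; left; apply/eqP.
    set s := (r2 `^ g - r1 `^ g)%R.
    have s0 : (s != 0)%R.
      by rewrite gt_eqF// subr_gt0 gt0_ltr_powR// nnegrE ltW// (lt_trans r10).
    have -> : (g / (4 * N%:R * s) = (2 * N%:R)^-1 * (g / (2 * s)))%R.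
      by field; rewrite s0 pnatr_eq0.
    by rewrite exprMn exprVn !mulrA.
  rewrite lee_wpmul2l ?weighted_energy_ge ?(ltW hint)//.
    by rewrite lee_fin divr_ge0// exprn_ge0.
rewrite -ge0_integralZl_EFin//; last 3 first.
- move=> r /=; rewrite in_itv/= => /andP[r1r _].
  by rewrite lee_fin mulr_ge0 ?exprn_ge0 ?fun_ge0// divr_ge0 ?powR_ge0// ltW// (lt_trans r10).
- apply: measurable_funTS; apply/measurable_EFinP; apply: measurable_funM; apply: measurable_funX => //.
  exact: measurable_funM.
- by rewrite divr_ge0// exprn_ge0.
rewrite integral_mkcond [leRHS]integral_mkcond.
apply: le_integral_nomeas => r _.
  rewrite /patch; case: ifPn => //; rewrite mem_setE in_itv/= => /andP[r1r _].
  have r0 := lt_trans r10 r1r; apply: mule_ge0; rewrite lee_fin.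
    by rewrite divr_ge0// exprn_ge0.
  apply: mulr_ge0; apply: exprn_ge0; last exact: fun_ge0.
  by rewrite divr_ge0 ?powR_ge0// ltW.
rewrite /patch !mem_setE !in_itv/= andbT /F.
have [Hr|_] := boolP (r1 < r < r2)%R; last first.
  by case: ifPn => // _; rewrite mule0.
have r0 : (0 < r)%R by case/andP: Hr => /(lt_trans r10).
rewrite r0 -!EFinM lee_fin le_eqVlt; apply/orP; left; apply/eqP.
by rewrite -/N !expr_div_n; ring.
Qed.

End ring_energy.

(** * Volumes of cubes and cube shells in the sup norm *)

Section cubes.
Context {R : realType}.
Local Open Scope ereal_scope.
Local Notation mu := (@lebesgue_measure R).
Local Arguments intRn : simpl never.

Lemma coord_le_norm (n : nat) (x : 'rV[R]_n) i : (`|x ord0 i| <= `|x|)%R.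
Proof.
rewrite [leRHS]mx_normrE.
exact: (le_bigmax (0%R : R) (fun ij : 'I_1 * 'I_n => `|x ij.1 ij.2|%R) (ord0, i)).
Qed.

Lemma norm_rV_le (n : nat) (x : 'rV[R]_n) (c : R) : (0 <= c)%R ->
  (forall i, `|x ord0 i| <= c)%R -> (`|x| <= c)%R.
Proof.
move=> c0 H; rewrite [leLHS]mx_normrE; apply: bigmax_le => // -[i j] _ /=.
by rewrite (ord1 i).
Qed.

Lemma norm_row_mx (n : nat) (t : R) (y : 'rV[R]_n) :
  (`|row_mx (\row_(j < 1) t) y : 'rV_n.+1| = Num.max `|t| `|y|)%R.
Proof.
apply/eqP; rewrite eq_le; apply/andP; split.
  apply: norm_rV_le => [|i]; first by rewrite le_max normr_ge0.
  rewrite le_max; case: (@split_ordP 1 n i) => j ->.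
    by rewrite (@row_mxEl _ 1 1 n) mxE lexx.
  by rewrite (@row_mxEr _ 1 1 n) coord_le_norm orbT.
rewrite ge_max; apply/andP; split.
  have := coord_le_norm _ (row_mx (\row_(j < 1) t) y : 'rV_n.+1) (@lshift 1 n ord0).
  by rewrite (@row_mxEl _ 1 1 n) mxE.
apply: norm_rV_le => // i.
have := coord_le_norm _ (row_mx (\row_(j < 1) t) y : 'rV_n.+1) (@rshift 1 n i).
by rewrite (@row_mxEr _ 1 1 n).
Qed.

Lemma intRn0 (n : nat) : intRn (fun _ : 'rV[R]_n => 0) = 0.
Proof.
elim: n => [//|n IH]; rewrite intRnS//.
by rewrite integral0_eq// => t _; rewrite IH.
Qed.

Lemma intRn_cube_le (n : nat) (c : R) : (0 <= c)%R ->
  intRn (fun y : 'rV[R]_n => if (`|y| <= 2)%R then c%:E else 0) <= (c * 4 ^+ n)%:E.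
Proof.
move=> c0; elim: n => [|n IH].
  by rewrite /intRn expr0 mulr1; case: ifP; rewrite lee_fin.
rewrite intRnS; last by move=> x; case: ifP; rewrite ?lee_fin.
apply: (@le_trans _ _ (\int[mu]_(t in `[(- 2)%R, 2%R]) (c * 4 ^+ n)%:E)).
  rewrite [leRHS]integral_mkcond; apply: le_integral_nomeas => t _.
    by apply: intRn_ge0 => x; case: ifP; rewrite ?lee_fin.
  rewrite /patch mem_setE in_itv/= -ler_norml; case: ifPn => t2.
    apply: le_trans IH; apply: le_intRn => y; first by case: ifP; rewrite ?lee_fin.
    by rewrite norm_row_mx ge_max t2.
  apply: (@le_trans _ _ (intRn (fun _ : 'rV_n => 0))); last by rewrite intRn0.
  apply: le_intRn => y; first by case: ifP; rewrite ?lee_fin.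
  by rewrite norm_row_mx ge_max (negbTE t2).
rewrite integral_cst//= lebesgue_measure_itv/= lte_fin ifT; last by lra.
by rewrite -EFinB -EFinM lee_fin exprSr; lra.
Qed.

(** Slicing by the first coordinate [t]: for [|t| < t1] the slice is a shell of one dimension less,
    for [t1 <= |t| <= t2] it lies in a cube of side [4], and beyond [t2] it is empty. *)
Lemma intRn_shell_le (n : nat) (c t1 t2 : R) :
  (0 <= c)%R -> (0 < t1)%R -> (t1 < t2)%R -> (t2 <= 2)%R ->
  intRn (fun y : 'rV[R]_n => if (t1 <= `|y| <= t2)%R then c%:E else 0) <=
    (c * (n%:R * 4 ^+ n * (t2 - t1)))%:E.
Proof.
move=> c0 t10 lt12 t22; have t12 := ltW lt12; elim: n => [|n IH].
  by rewrite /intRn normr0 (leNgt t1 0%R) t10/= !mul0r mulr0.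
rewrite intRnS; last by move=> x; case: ifP; rewrite ?lee_fin.
set A := (c * (n%:R * 4 ^+ n * (t2 - t1)))%R; set B := (c * 4 ^+ n)%R.
have A0 : (0 <= A)%R by rewrite !mulr_ge0// ?subr_ge0// exprn_ge0.
have B0 : (0 <= B)%R by rewrite mulr_ge0// exprn_ge0.
have mi (D : set (measurableTypeR R)) : measurable D ->
  measurable_fun setT (fun t => (\1_D t)%:E : \bar R).
  by move=> mD; apply/measurable_EFinP; exact: measurable_indic.
pose G t : \bar R := A%:E * (\1_(`[(- 2)%R, 2%R]) t)%:E +
   (B%:E * (\1_(`[t1, t2]) t)%:E + B%:E * (\1_(`[(- t2)%R, (- t1)%R]) t)%:E).
apply: (@le_trans _ _ (\int[mu]_t G t)).
  apply: le_integral_nomeas => t _.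
    by apply: intRn_ge0 => x; case: ifP; rewrite ?lee_fin.
  have f0 y : 0 <= (if (t1 <= `|row_mx (\row_(j < 1) t) y : 'rV_n.+1| <= t2)%R
                   then c%:E else 0 : \bar R) by case: ifP; rewrite ?lee_fin.
  rewrite /G -!EFinM -!EFinD !indicE !mem_setE !in_itv/= -ler_norml.
  have [tt1|tt1] := ltP `|t|%R t1.
    apply: (@le_trans _ _ A%:E).
      apply: le_trans IH; apply: le_intRn => // y; rewrite norm_row_mx le_max ge_max.
      rewrite leNgt tt1/= (le_trans (ltW tt1) t12)/=.
      by [].
    have -> : (`|t| <= 2)%R by rewrite (le_trans (ltW tt1))// (le_trans t12).
    by rewrite lee_fin mulr1 lerDl addr_ge0// mulr_ge0.
  have [tt2|tt2] := leP `|t|%R t2.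
    apply: (@le_trans _ _ B%:E).
      apply: le_trans (intRn_cube_le n c c0); apply: le_intRn => // y.
      rewrite norm_row_mx ge_max; case: ifPn => [/andP[_ /andP[_ h]]|_].
        by rewrite (le_trans h t22).
      by case: ifP; rewrite ?lee_fin.
    rewrite lee_fin; apply: ler_wpDl; first exact: (mulr_ge0 A0 (ler0n _ _)).
    move: tt1 tt2.
    have [t0|t0] := leP 0%R t.
      rewrite ger0_norm// => -> ->; rewrite mulr1 lerDl; exact: (mulr_ge0 B0 (ler0n _ _)).
    rewrite ltr0_norm// => h1 h2.
    have -> : (- t2 <= t <= - t1)%R by lra.
    by rewrite mulr1 lerDr; exact: (mulr_ge0 B0 (ler0n _ _)).
  apply: (@le_trans _ _ 0); last first.
    rewrite lee_fin addr_ge0 ?addr_ge0// ?(mulr_ge0 A0 (ler0n _ _))//;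
    exact: (mulr_ge0 B0 (ler0n _ _)).
  apply: (@le_trans _ _ (intRn (fun _ : 'rV_n => 0))); last by rewrite intRn0.
  apply: le_intRn => // y.
  by rewrite norm_row_mx ge_max [(`|t| <= t2)%R]leNgt tt2 andbF.
rewrite /G ge0_integralD//=; last 4 first.
- by move=> t _; rewrite -EFinM lee_fin mulr_ge0.
- by apply: emeasurable_funM => //; exact: mi.
- by move=> t _; rewrite -!EFinM -EFinD lee_fin addr_ge0// mulr_ge0.
- by apply: emeasurable_funD; apply: emeasurable_funM => //; exact: mi.
rewrite ge0_integralD//=; last 4 first.
- by move=> t _; rewrite -EFinM lee_fin mulr_ge0.
- by apply: emeasurable_funM => //; exact: mi.
- by move=> t _; rewrite -EFinM lee_fin mulr_ge0.
- by apply: emeasurable_funM => //; exact: mi.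
rewrite !ge0_integralZl_EFin//; last 3 first.
- by apply: mi.
- by apply: mi.
- by apply: mi.
rewrite !integral_indic// !setIT/= !lebesgue_measure_itv/= !lte_fin.
rewrite ifT; last by lra.
rewrite ltrN2 lt12 -!EFinB -!EFinM -!EFinD lee_fin /A /B exprS -[n.+1%:R]natr1.
(* The slices add up to [c (t2 - t1) 4^n (4 n + 2)], and the claim has [4 n + 4]; this is the
   difference. *)
have a0 : (0 <= 2 * 4 ^+ n * (t2 - t1) * c :> R)%R.
  by rewrite !mulr_ge0 ?exprn_ge0 ?subr_ge0.
by rewrite -subr_ge0; move: a0; congr (_ <= _)%R; ring.
Qed.

End cubes.

(** * Upper bound for the modulus of curves crossing a cube shell *)

Section modulus_bound.
Context {R : realType}.
Local Open Scope ereal_scope.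
Local Notation mu := (@lebesgue_measure R).
Local Arguments intRn : simpl never.

Lemma norm_le_enorm (n : nat) (x : 'rV[R]_n) : (`|x| <= enorm x)%R.
Proof.
apply: norm_rV_le => [|i]; first exact: enorm_ge0.
rewrite -sqrtr_sqr; apply: ler_wsqrtr; rewrite (bigD1 i)//= lerDl.
by apply: sumr_ge0 => j _; exact: sqr_ge0.
Qed.

Lemma Rn_borel_open (n : nat) (U : set 'rV[R]_n) : open U -> Rn_borel U.
Proof. by move=> oU; exact: sub_sigma_algebra. Qed.

(** The shell is closed and carries the larger value, so a strict sublevel set is empty, the whole
    space or the open complement of the shell. *)
Lemma Rn_borel_fun_shell (n : nat) (c t1 t2 : R) : (0 <= c)%R ->
  Rn_borel_fun (fun y : 'rV[R]_n => if (t1 <= `|y| <= t2)%R then c%:E else 0).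
Proof.
move=> c0 t; apply: Rn_borel_open.
have cn : continuous (fun y : 'rV[R]_n => `|y|%R) by exact: norm_continuous.
have [t0|t0] := leP t 0%R.
  rewrite (_ : [set _ | _] = set0); first exact: open0.
  apply/seteqP; split => // y /=; rewrite ltNge => /negP; apply.
  by case: ifPn => _; rewrite lee_fin// (le_trans t0).
have [ct|ct] := ltP c t.
  rewrite (_ : [set _ | _] = setT); first exact: openT.
  by apply/seteqP; split => // y _ /=; case: ifPn => _; rewrite lte_fin.
rewrite (_ : [set _ | _] = (fun y : 'rV[R]_n => `|y|%R) @^-1` [set r | r < t1]%R `|`
    (fun y : 'rV[R]_n => `|y|%R) @^-1` [set r | r > t2]%R).
  by apply: openU; apply: open_comp.
apply/seteqP; split => y /=.
  case: ifPn => [_|]; first by rewrite lte_fin ltNge ct.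
  by rewrite negb_and -!ltNge => /orP[|] ? _; [left|right].
by move=> [h|h]; rewrite ifF ?lte_fin//; apply/negP => /andP[h1 h2]; lra.
Qed.

Lemma curve_length_ge (n : nat) (gam : R -> 'rV[R]_n) :
  (`|gam 1%R| - `|gam 0%R|)%:E <= curve_length gam 0 1.
Proof.
apply: (@le_trans _ _ (polysum gam [:: 0%R; 1%R])%:E).
  rewrite lee_fin /polysum/= big_cons big_nil/= addr0.
  exact: le_trans (lerB_dist _ _) (norm_le_enorm _ _).
by apply: ereal_sup_ubound; exists [::] => //=; rewrite ler01.
Qed.

(** The infimum defining the parameter is taken over a nonempty subset of [[0, 1]]. Knowing that the
    point lies on the curve suffices later, because the test density is constant along the curves
    considered. *)
Lemma arclen_paramP (n : nat) (gam : R -> 'rV[R]_n) (s : R) :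
  s%:E <= curve_length gam 0 1 ->
  exists2 t, (0 <= t <= 1)%R & arclen_param gam s = gam t.
Proof.
move=> sL; rewrite /arclen_param; set S := [set t | _].
have S1 : S 1%R by split => //; rewrite ler01 lexx.
have lbS : lbound S 0%R by move=> t [/andP[]].
exists (inf S) => //; apply/andP; split.
  by apply: lb_le_inf lbS; exists 1%R.
by apply: ge_inf S1; exists 0%R.
Qed.

(** The density [1 / (t2 - t1)] on the shell is admissible because a curve of the family has length
    at least [t2 - t1], by its single chord. Its energy is [(t2 - t1)^(-n-1)] times the shell
    volume, which is linear in [t2 - t1]. *)
Lemma modulus_shell_le (n : nat) (Gam : set (R -> 'rV[R]_n.+1)) (t1 t2 : R) :
  (0 < t1)%R -> (t1 < t2)%R -> (t2 <= 2)%R ->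
  (forall gam, Gam gam -> `|gam 0| = t1 /\ `|gam 1| = t2)%R ->
  (forall gam, Gam gam -> forall t, 0 <= t <= 1 -> t1 <= `|gam t| <= t2)%R ->
  modulus Gam <= (n.+1%:R * 4 ^+ n.+1 / (t2 - t1) ^+ n)%:E.
Proof.
move=> t10 t12 t22 G01 Gt.
have d0 : (0 < t2 - t1)%R by rewrite subr_gt0.
set c := ((t2 - t1)^-1)%R; have c0 : (0 < c)%R by rewrite invr_gt0.
pose rho (y : 'rV[R]_n.+1) : \bar R := if (t1 <= `|y| <= t2)%R then c%:E else 0.
have rho0 y : 0 <= rho y by rewrite /rho; case: ifP => // _; rewrite lee_fin ltW.
apply: (@le_trans _ _ (intRn (fun x => rho x ^+ n.+1))).
  apply: ereal_inf_lbound; exists rho => //; split.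
    exact: Rn_borel_fun_shell (ltW c0).
  split => // gam Ggam rect.
  have Loo : curve_length gam 0 1 < +oo by exact: rect.
  have := curve_length_ge n.+1 gam; have [-> ->] := G01 _ Ggam.
  rewrite /line_integral; move: Loo (arclen_paramP n.+1 gam).
  case: (curve_length gam 0 1) => [L| |]// _ arc; rewrite lee_fin => dL.
  have L0 : (0 < L)%R by exact: lt_le_trans dL.
  apply: (@le_trans _ _ (\int[@completed_lebesgue_measure R]_(s in `[0%R, L]) c%:E)).
    rewrite integral_mkcond ge0_integral_completed; last first.
      by move=> s; rewrite /patch; case: ifP => // _; rewrite lee_fin ltW.
    rewrite -integral_mkcond integral_cst//= lebesgue_measure_itv/= lte_fin L0.
    by rewrite sube0 -EFinM lee_fin -(mulVf (lt0r_neq0 d0)) ler_pM2l.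
  apply: le_integral_nomeas => s /=; first by rewrite lee_fin ltW.
  rewrite in_itv/= => /andP[_ sL]; have [|t t01 ->] := arc s; first by rewrite lee_fin.
  by rewrite /rho Gt.
apply: (@le_trans _ _ (intRn (fun y : 'rV[R]_n.+1 =>
    if (t1 <= `|y| <= t2)%R then (c ^+ n.+1)%:E else 0))).
  apply: le_intRn => y; first exact: expe_ge0.
  by rewrite /rho; case: ifP; rewrite ?EFin_expe// expeS mul0e.
have cn0 : (0 <= c ^+ n.+1)%R by rewrite exprn_ge0// ltW.
apply: le_trans (intRn_shell_le n.+1 _ _ _ cn0 t10 t12 t22) _.
rewrite lee_fin /c exprVn exprS le_eqVlt; apply/orP; left; apply/eqP; field.
by rewrite expf_neq0 gt_eqF.
Qed.

End modulus_bound.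

(** * Integrability of [|x|^(-1/2)] on the unit ball *)

Section integrability.
Context {R : realType}.
Local Open Scope ereal_scope.
Local Notation mu := (@lebesgue_measure R).
Local Arguments intRn : simpl never.

Lemma integral_invsqrt_itv01_lty :
  \int[mu]_(t in `]0%R, 1%R[) (t `^ (- 2^-1))%:E < +oo.
Proof.
(* The interval is exhausted from the right of [0]; on each piece the antiderivative [2 sqrt(t)]
   bounds the integral by [2]. *)
pose F (i : nat) : set (measurableTypeR R) := `](i.+2%:R^-1)%R, 1%R[%classic.
have FE : \bigcup_i F i = (`]0%R, 1%R[%classic : set R).
  apply/seteqP; split => [t [i _]|t]; rewrite /F /= !in_itv/=.
    by move=> /andP[h ->]; rewrite (lt_trans _ h).
  move=> /andP[t0 t1]; exists (Num.bound t^-1) => //=; rewrite in_itv/= t1 andbT.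
  rewrite invf_plt ?posrE//; apply: (@lt_le_trans _ _ (Num.bound t^-1)%:R).
    by apply: archi_boundP; rewrite invr_ge0 ltW.
  by rewrite ler_nat ltnW.
have mf : measurable_fun [set: measurableTypeR R] (fun t : R => (t `^ (- 2^-1))%:E).
  by apply/measurable_EFinP; exact: measurable_powR.
have ndF : nondecreasing_seq F.
  move=> i j ij; apply/subsetPset => t; rewrite /F /= !in_itv/= => /andP[h ->].
  by rewrite andbT (le_lt_trans _ h)// lef_pV2 ?posrE// ler_nat !ltnS.
have H := @ge0_nondecreasing_set_cvg_integral _ _ _ F
  (fun t : R => (t `^ (- 2^-1))%:E) mu ndF (fun i => measurable_itv _)
  (fun i => measurable_funTS mf) (fun i t _ => powR_ge0 t (- 2^-1)%R).
apply: (@le_lt_trans _ _ 2%:E); last by rewrite ltry.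
rewrite -FE -(cvg_lim _ H)//; apply: lime_le; first by apply: cvgP; exact: H.
apply: nearW => i.
rewrite /F (_ : - 2^-1 = 2^-1 - 1 :> R)%R; last lra.
rewrite integral_powR// ?invr_gt0// ?invf_lt1 ?ltr1n//.
rewrite lee_fin powR1 invrK.
have := powR_ge0 (i.+2%:R^-1 : R)%R 2^-1%R; lra.
Qed.

Definition invsqrt_bump (t : R) : R := if (0 < `|t| < 1)%R then (`|t| `^ (- 2^-1))%R else 0%R.

Lemma invsqrt_bump_ge0 t : (0 <= invsqrt_bump t)%R.
Proof. by rewrite /invsqrt_bump; case: ifP => // _; exact: powR_ge0. Qed.

Lemma measurable_invsqrt_bump : measurable_fun [set: measurableTypeR R] invsqrt_bump.
Proof.
have mn : measurable_fun [set: measurableTypeR R] (fun t : R => `|t|%R).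
  exact: normr_measurable.
apply: measurable_fun_ifT => //.
  by apply: measurable_and; apply: measurable_fun_ltr.
exact: (measurableT_comp (measurable_powR (- 2^-1)%R) mn).
Qed.

Lemma integral_invsqrt_bump_lty : \int[mu]_t (invsqrt_bump t)%:E < +oo.
Proof.
have mb : measurable_fun [set: R] (EFin \o invsqrt_bump).
  by apply/measurable_EFinP; exact: measurable_invsqrt_bump.
have b0 t : 0 <= (EFin \o invsqrt_bump) t by rewrite /= lee_fin invsqrt_bump_ge0.
have bN t : invsqrt_bump (- t)%R = invsqrt_bump t by rewrite /invsqrt_bump normrN.
have H : \int[mu]_(t in `[0%R, +oo[) (invsqrt_bump t)%:E < +oo.
  apply: le_lt_trans integral_invsqrt_itv01_lty.
  rewrite integral_mkcond [leRHS]integral_mkcond; apply: le_integral_nomeas => t _.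
    by rewrite /patch; case: ifP => // _; exact: b0.
  rewrite /patch !mem_setE !in_itv/= andbT /invsqrt_bump.
  have [t0|t0] := leP 0%R t; last by case: ifP; rewrite ?lee_fin ?powR_ge0.
  by rewrite (ger0_norm t0); case: ifP.
(* The bump is even, so reflection reduces the negative half-line to the positive one. *)
have H' : \int[mu]_(t in `]-oo, 0%R]) (invsqrt_bump t)%:E < +oo.
  have := ge0_integration_by_substitution0 mb b0.
  by under [X in _ = X -> _]eq_integral do rewrite /= bN; move=> <-.
apply: (@le_lt_trans _ _ (\int[mu]_(t in `[0%R, +oo[) (invsqrt_bump t)%:E +
   \int[mu]_(t in `]-oo, 0%R]) (invsqrt_bump t)%:E)); last by rewrite lte_add_pinfty.
rewrite [X in X + _]integral_mkcond [X in _ + X]integral_mkcond -ge0_integralD//; last 4 first.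
- by move=> t _; rewrite /patch; case: ifP => // _; exact: b0.
- by apply/(measurable_restrictT _ _).1 => //; exact: measurable_funTS.
- by move=> t _; rewrite /patch; case: ifP => // _; exact: b0.
- by apply/(measurable_restrictT _ _).1 => //; exact: measurable_funTS.
apply: le_integral_nomeas => t _; first exact: b0.
rewrite /patch !mem_setE !in_itv/= andbT.
by have [t0|t0] := leP 0%R t; [case: ifP => _; rewrite ?adde0// leeDl//; exact: b0
  |rewrite (ltW t0) add0e].
Qed.

(** The first coordinate satisfies [|t| <= |x|], so [|x|^(-1/2) <= |t|^(-1/2)], while the other
    coordinates stay in a cube and contribute [4^k]. The exponent [1/2] thus works in every
    dimension. *)
Lemma intRn_invsqrt_lty (k : nat) (f : 'rV[R]_k.+1 -> \bar R) (M : R) :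
  (0 <= M)%R -> (forall x, 0 <= f x) ->
  (forall x, (0 < enorm x < 1)%R -> f x <= (M * enorm x `^ (- 2^-1))%:E) ->
  intRn (fun x => if x \in unit_ball then f x else 0) < +oo.
Proof.
move=> M0 f0 fM.
have F0 x : 0 <= (if x \in unit_ball then f x else 0) by case: ifP.
rewrite intRnS//.
(* On the slice [t = 0], which contains the origin, the trivial bound [+oo] is taken; a single value
   of [t] is negligible. *)
pose B (t : R) : \bar R := if (0 < `|t|)%R then (M * 4 ^+ k * invsqrt_bump t)%:E else +oo.
have mb := measurable_invsqrt_bump.
have mn : measurable_fun [set: measurableTypeR R] (fun t : R => `|t|%R).
  exact: normr_measurable.
have mMb : measurable_fun [set: measurableTypeR R] (fun t => (M * 4 ^+ k * invsqrt_bump t)%:E).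
  by apply/measurable_EFinP; apply: measurable_funM.
have mB : measurable_fun [set: measurableTypeR R] B.
  by apply: measurable_fun_ifT => //; exact: measurable_fun_ltr.
have c0 : (0 <= M * 4 ^+ k)%R by rewrite mulr_ge0// exprn_ge0.
have Mb0 t : 0 <= (M * 4 ^+ k * invsqrt_bump t)%:E.
  by rewrite lee_fin mulr_ge0// invsqrt_bump_ge0.
have B0 t : 0 <= B t by rewrite /B; case: ifP => _; rewrite ?leey.
apply: (@le_lt_trans _ _ (\int[mu]_t B t)).
  apply: le_integral_nomeas => t _; first exact: intRn_ge0.
  rewrite /B; case: ifPn => [t0|_]; last by rewrite leey.
  have et y : (`|t| <= enorm (row_mx (\row_(j < 1) t) y : 'rV_k.+1))%R.
    by apply: le_trans (norm_le_enorm _ _); rewrite norm_row_mx le_max lexx.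
  have [t1|t1] := ltP `|t|%R 1%R; last first.
    apply: (@le_trans _ _ (intRn (fun _ : 'rV_k => 0))); last by rewrite intRn0.
    apply: le_intRn => // y; rewrite memNset// /unit_ball /= => h.
    by have := le_lt_trans (et y) h; rewrite ltNge t1.
  have p0 : (0 <= M * `|t| `^ (- 2^-1))%R by rewrite mulr_ge0// powR_ge0.
  rewrite /invsqrt_bump t0 t1/= mulrAC.
  apply: le_trans (intRn_cube_le k _ p0); apply: le_intRn => // y.
  case: ifPn => [|_]; last by case: ifP; rewrite ?lee_fin.
  rewrite inE /unit_ball /= => e1; rewrite ifT; last first.
    have := le_lt_trans (norm_le_enorm _ _) e1; rewrite norm_row_mx gt_max => /andP[_ h].
    lra.
  apply: le_trans (fM _ _) _; first by rewrite e1 (lt_le_trans t0).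
  rewrite lee_fin ler_wpM2l// !powRN lef_pV2 ?posrE ?powR_gt0//.
    by rewrite ge0_ler_powR// nnegrE// enorm_ge0.
  exact: lt_le_trans (et y).
rewrite (ge0_ae_eq_integral (g := fun t : measurableTypeR R => (M * 4 ^+ k * invsqrt_bump t)%:E))//; last first.
  exists [set 0%R]; split => //; first exact: lebesgue_measure_set1.
  move=> t /=; apply: contra_notP => t0 _; rewrite /B normr_gt0.
  by case: eqP.
under eq_integral do rewrite EFinM.
rewrite ge0_integralZl_EFin//; last 2 first.
- by move=> t _; rewrite lee_fin invsqrt_bump_ge0.
- by apply/measurable_EFinP.
by rewrite lte_mul_pinfty// ?integral_invsqrt_bump_lty.
Qed.

End integrability.

(** * The maps [g_m]: inverse, continuity and failure of equicontinuity *)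

Section stretch.
Context {R : realType}.

Lemma enormZ (n : nat) (a : R) (x : 'rV[R]_n) : enorm (a *: x) = `|a| * enorm x.
Proof.
rewrite /enorm -sqrtr_sqr -sqrtrM ?sqr_ge0// mulr_sumr.
by congr Num.sqrt; apply: eq_bigr => i _; rewrite mxE exprMn.
Qed.

Lemma enorm_le_norm (n : nat) (x : 'rV[R]_n) : enorm x <= n%:R * `|x|.
Proof.
rewrite -[leRHS]ger0_norm ?mulr_ge0// -sqrtr_sqr; apply: ler_wsqrtr.
apply: (@le_trans _ _ (\sum_(i < n) `|x| ^+ 2)).
  apply: ler_sum => i _; rewrite -[x ord0 i ^+ 2]real_normK ?num_real//.
  by rewrite lerXn2r ?nnegrE// coord_le_norm.
rewrite sumr_const card_ord -[leLHS]mulr_natl exprMn ler_wpM2r ?sqr_ge0//.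
by rewrite -natrX ler_nat; case: n {x} => // n; rewrite leq_pmulr.
Qed.

Lemma enorm_gt0 (n : nat) (x : 'rV[R]_n) : (0 < enorm x) = (x != 0).
Proof.
apply/idP/idP => [|x0]; first by apply: contraTN => /eqP ->; rewrite enorm0 ltxx.
by apply: lt_le_trans (norm_le_enorm n x); rewrite normr_gt0.
Qed.

Lemma enorm_continuous (n : nat) : continuous (@enorm R n).
Proof.
move=> x; apply: continuous_comp; last exact: sqrt_continuous.
have csq i : {for x, continuous (fun M : 'rV[R]_n => M ord0 i ^+ 2)}.
  apply: (@continuous_comp _ _ _ (fun M : 'rV[R]_n => M ord0 i) (fun r : R => r ^+ 2)).
    exact: coord_continuous.
  exact: exprn_continuous.
by apply: (cvg_big (@add_continuous R^o) (nbhs_filter x)) => i _; exact: csq.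
Qed.

Definition stretch (m : nat) (s : R) : R := Num.min (m.+2%:R * s) (1 + s).
(** The inverse of a minimum of two increasing bijections is the maximum of their inverses. *)
Definition unstretch (m : nat) (t : R) : R := Num.max (t / m.+2%:R) (t - 1).

Lemma stretchK m s : 0 <= s -> unstretch m (stretch m s) = s.
Proof.
move=> s0; rewrite /unstretch /stretch.
have m0 : 0 < m.+2%:R^-1 :> R by rewrite invr_gt0.
have [h|h] := leP (m.+2%:R * s) (1 + s).
  by rewrite mulrAC divff ?pnatr_eq0// mul1r max_l// lerBlDl.
rewrite addrAC subrr add0r max_r//.
by rewrite ler_pdivrMr// mulrC ltW.
Qed.

(** Both branches have slope at least [1], and this survives taking the minimum. *)
Lemma stretch_ge m s s' : s <= s' -> s' - s <= stretch m s' - stretch m s.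
Proof.
move=> ss; have m1 : 1 <= m.+2%:R :> R by rewrite ler1n.
rewrite /stretch.
have [h|h] := leP (m.+2%:R * s) (1 + s); have [h'|h'] := leP (m.+2%:R * s') (1 + s'); nra.
Qed.

Lemma stretch_le m s : 0 <= s -> stretch m s <= m.+2%:R * s.
Proof. by rewrite /stretch ge_min lexx. Qed.

Lemma stretch_gt0 m s : 0 < s -> 0 < stretch m s.
Proof. by move=> s0; rewrite /stretch lt_min mulr_gt0//= addr_gt0. Qed.

Lemma stretch_continuous m : continuous (stretch m).
Proof.
move=> s; apply: continuous_min.
  by apply: cvgMr; exact: cvg_id.
by apply: cvgD; [exact: cvg_cst|exact: cvg_id].
Qed.

Lemma unstretch_continuous m : continuous (unstretch m).
Proof.
move=> s; apply: (@continuous_max R R (fun t : R => t / m.+2%:R) (fun t : R => t - 1)).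
  by apply: cvgMl; exact: cvg_id.
by apply: cvgB; [exact: cvg_id|exact: cvg_cst].
Qed.

Lemma powR_rootK (K : nat) (r : R) : 0 <= r -> (r `^ (K.+1%:R^-1)) ^+ K.+1 = r.
Proof.
move=> r0; rewrite -powR_mulrn ?powR_ge0// -powRrM mulVf ?pnatr_eq0//.
by rewrite powRr1.
Qed.

Lemma powR_root_exp (K : nat) (r : R) : 0 <= r -> (r ^+ K.+1) `^ (K.+1%:R^-1) = r.
Proof.
move=> r0; rewrite -powR_mulrn// -powRrM mulfV ?pnatr_eq0//.
by rewrite powRr1.
Qed.

(* Radial with respect to the Euclidean norm in the source and to the sup norm
   in the target, so that spheres go to boundaries of cubes, whose volume is
   elementary. *)
Definition ball_stretch (n K m : nat) (x : 'rV[R]_n) : 'rV[R]_n :=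
  (stretch m (enorm x `^ (K.+1%:R^-1)) / `|x|) *: x.

(** Inverse along the same ray: the sup norm of [y] determines the Euclidean radius of the source,
    and the power [K.+1] undoes the root. *)
Definition ball_unstretch (n K m : nat) (y : 'rV[R]_n) : 'rV[R]_n :=
  (unstretch m `|y| ^+ K.+1 / enorm y) *: y.

Lemma norm_ball_stretch n K m (x : 'rV[R]_n) : x != 0 ->
  `|ball_stretch n K m x| = stretch m (enorm x `^ (K.+1%:R^-1)).
Proof.
move=> x0; rewrite normrZ normrM normfV normr_id mulfVK ?normr_eq0//.
by rewrite gtr0_norm// stretch_gt0// powR_gt0// enorm_gt0.
Qed.

Lemma ball_stretchK n K m (x : 'rV[R]_n) : x != 0 ->
  ball_unstretch n K m (ball_stretch n K m x) = x.
Proof.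
move=> x0; rewrite /ball_unstretch norm_ball_stretch// stretchK ?powR_ge0//.
rewrite powR_rootK ?enorm_ge0// /ball_stretch enormZ scalerA.
set a := _ / `|x|; have a0 : 0 < a.
  by rewrite divr_gt0 ?normr_gt0// stretch_gt0// powR_gt0// enorm_gt0.
rewrite gtr0_norm// -[RHS]scale1r; congr (_ *: _).
by field; rewrite !gt_eqF// enorm_gt0.
Qed.

Lemma ball_stretch_homeo n K m : homeo_onto_image punct_ball (ball_stretch n K m).
Proof.
split; [|split].
- apply: continuous_in_subspaceT => x; rewrite inE => -[_ x0].
  suff H : {for x, continuous (fun x : 'rV[R]_n =>
      stretch m (enorm x `^ (K.+1%:R^-1)) / `|x|)} by exact: (cvgZ H cvg_id).
  apply: continuousM; last first.
    by apply: continuousV; [rewrite normr_eq0|exact: norm_continuous].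
  apply: (@continuous_comp _ _ _ (fun x : 'rV[R]_n => enorm x `^ (K.+1%:R^-1))
    (stretch m)); last exact: stretch_continuous.
  apply: (@continuous_comp _ _ _ (@enorm R n) (fun r : R => r `^ (K.+1%:R^-1))).
    exact: enorm_continuous.
  by apply: powR_continuous_gt0; rewrite enorm_gt0.
- move=> x y; rewrite !inE => -[_ x0] [_ y0] E.
  by rewrite -(ball_stretchK n K m _ x0) E ball_stretchK.
- exists (ball_unstretch n K m); split => [x [_ x0]|]; first exact: ball_stretchK.
  apply: continuous_in_subspaceT => _ /set_mem [x [_ x0] <-].
  have y0 : ball_stretch n K m x != 0.
    by rewrite -normr_gt0 norm_ball_stretch// stretch_gt0// powR_gt0// enorm_gt0.
  move: (ball_stretch n K m x) y0 => y y0.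
  suff H : {for y, continuous (fun y : 'rV[R]_n =>
      unstretch m `|y| ^+ K.+1 / enorm y)} by exact: (cvgZ H cvg_id).
  apply: continuousM; last first.
    apply: continuousV; last exact: enorm_continuous.
    by rewrite gt_eqF// enorm_gt0.
  apply: (@continuous_comp _ _ _ (fun y : 'rV[R]_n => unstretch m `|y|)
    (fun r : R => r ^+ K.+1)); last exact: exprn_continuous.
  apply: (@continuous_comp _ _ _ (fun y : 'rV[R]_n => `|y|) (unstretch m)).
    exact: norm_continuous.
  exact: unstretch_continuous.
Qed.

Lemma ball_stretch_cont_ext n K m : cont_ext_at0 (ball_stretch n.+1 K m) 0.
Proof.
(* The factor [n.+1] compares the Euclidean norm with the sup norm, [m.+2] bounds the growth of
   [stretch], and the power [K.+1] below compensates the root. *)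
move=> e e0; pose e' := e / (n.+1%:R * m.+2%:R).
have e'0 : 0 < e' by rewrite divr_gt0// mulr_gt0.
exists (e' ^+ K.+1); first exact: exprn_gt0.
move=> x [_ x0] xd; rewrite subr0.
apply: le_lt_trans (enorm_le_norm _ _) _; rewrite norm_ball_stretch//.
set s := _ `^ _; have s0 : 0 <= s by exact: powR_ge0.
have se : s < e'.
  rewrite -(@ltr_pXn2r _ K.+1)// ?nnegrE ?(ltW e'0)//.
  by rewrite powR_rootK ?enorm_ge0.
apply: (@le_lt_trans _ _ (n.+1%:R * (m.+2%:R * s))).
  by rewrite ler_wpM2l// stretch_le.
by rewrite mulrA mulrC -ltr_pdivlMr// mulr_gt0.
Qed.

Lemma ball_stretch_not_equicont n K :
  ~ equicont_at0 (ball_stretch n.+1 K) (fun=> 0).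
Proof.
move=> /(_ 1 ltr01)[d d0 H].
(* The test point has root radius [u = 1/(m+1)], where [stretch m u >= 1] since both [(m+2)/(m+1)]
   and [1 + u] are at least [1]. The extra successor ensures [u < 1], so that the point lies in the
   ball. *)
pose m := (Num.bound d^-1).+1; pose u : R := m.+1%:R^-1.
have u0 : 0 < u by rewrite invr_gt0.
have u1 : u < 1 by rewrite invf_lt1// ltr1n.
have ud : u < d.
  rewrite invf_plt ?posrE//; apply: (@lt_le_trans _ _ (Num.bound d^-1)%:R).
    by apply: archi_boundP; rewrite invr_ge0 ltW.
  by rewrite ler_nat ltnW.
pose x : 'rV[R]_n.+1 := (u ^+ K.+1) *: delta_mx ord0 ord0.
have ex : enorm x = u ^+ K.+1.
  rewrite enormZ ger0_norm ?exprn_ge0 ?(ltW u0)// /enorm (bigD1 ord0)//= big1.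
    by rewrite mxE !eqxx expr1n addr0 sqrtr1 mulr1.
  by move=> i i0; rewrite mxE (negbTE i0) andbF expr0n.
have uK : u ^+ K.+1 <= u by rewrite exprS ler_piMr ?exprn_ile1 ?ltW.
have x0 : x != 0 by rewrite -enorm_gt0 ex exprn_gt0.
have := H m x; rewrite (negbTE x0) subr0 ex => /(_ _ _)/wrap[].
- by right; split => //; rewrite ex (le_lt_trans uK).
- exact: le_lt_trans ud.
rewrite ltNge => /negP; apply.
apply: le_trans (norm_le_enorm _ _); rewrite norm_ball_stretch// ex.
rewrite powR_root_exp ?(ltW u0)// /stretch le_min lerDl (ltW u0) andbT.
by rewrite ler_pdivlMr// mul1r ler_nat.
Qed.

End stretch.

(** * The weight [Q]: measurability and integrability *)

Section weight.
Context {R : realType}.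
Local Open Scope ereal_scope.

(** At the origin, for [g > 0], the convention for division by zero would give the value [1]; the
    value [+oo] keeps the strict sublevel sets open. *)
Definition ring_weight (k : nat) (g C : R) (x : 'rV[R]_k.+2) : \bar R :=
  if x == 0%R then +oo else (1 + C / (enorm x `^ g) ^+ k.+1)%:E.

Lemma ring_weight_ge1 k g C x : (0 <= C)%R -> 1 <= ring_weight k g C x.
Proof.
move=> C0; rewrite /ring_weight; case: ifP => _; rewrite ?leey// lee_fin lerDl.
by rewrite divr_ge0// exprn_ge0// powR_ge0.
Qed.

Lemma ring_weight_measurable k g C (t : R) :
  Rn_lebesgue_measurable [set x | unit_ball x /\ ring_weight k g C x < t%:E].
Proof.
set A := [set x | _].
suff oA : Rn_borel A.
  (* A Borel set serves as its own inner and outer approximation. *)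
  by exists A, A; do 4 split => //; rewrite setDv indic0 -[RHS](@intRn0 R k.+2).
apply: Rn_borel_open; rewrite openE => x [x1]; rewrite /ring_weight.
have [//|x0] := eqVneq x 0%R; rewrite lte_fin => xt.
have ce := @enorm_continuous R k.+2 x.
have ex0 : (0 < enorm x)%R by rewrite enorm_gt0.
have cf : {for x, continuous (fun x : 'rV[R]_k.+2 =>
    (1 + C / (enorm x `^ g) ^+ k.+1)%R)}.
  apply: (@continuous_comp _ _ _ (@enorm R k.+2)
    (fun r : R => 1 + C / (r `^ g) ^+ k.+1)%R) => //.
  apply: cvgD; first exact: cvg_cst.
  apply: cvgM; first exact: cvg_cst.
  apply: cvgV; first by rewrite gt_eqF// exprn_gt0// powR_gt0.
  apply: (@continuous_comp _ _ _ (fun r : R => r `^ g)%R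
    (fun r : R => r ^+ k.+1)%R); last exact: exprn_continuous.
  exact: powR_continuous_gt0.
rewrite /interior /A /=; near=> y; split.
  by rewrite /unit_ball /=; near: y; exact: cvgr_lt ce _ x1.
rewrite /ring_weight ifF; last first.
  by apply: negbTE; rewrite -enorm_gt0; near: y; exact: cvgr_gt ce _ ex0.
by rewrite lte_fin; near: y; exact: cvgr_lt cf _ xt.
Unshelve. all: by end_near. Qed.

(** In the ball [s = |x|^g <= 1], so the weight is at most [(1 + C) / s^(k+1)]; its power [p] is a
    multiple of [|x|^(-g(k+1)p)], whose exponent is at least [-1/2]. *)
Lemma ring_weight_Lp k g C (p : R) :
  (0 <= C)%R -> (0 <= g)%R -> (1 <= p)%R -> (g * k.+1%:R * p <= 2^-1)%R ->
  intRn (fun x => if x \in unit_ball then ring_weight k g C x `^ p else 0) < +oo.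
Proof.
move=> C0 g0 p1 gp; have p0 : (0 <= p)%R by exact: le_trans p1.
apply: (@intRn_invsqrt_lty R k.+1 _ ((1 + C) `^ p)%R); first exact: powR_ge0.
  by move=> x; exact: poweR_ge0.
move=> x /andP[r0 r1]; rewrite /ring_weight ifF; last first.
  by apply: negbTE; rewrite -enorm_gt0.
set r := enorm x in r0 r1 *; rewrite poweR_EFin lee_fin.
set s := (r `^ g)%R; have s0 : (0 < s)%R by exact: powR_gt0.
have s1 : (s <= 1)%R.
  by rewrite -(powRr0 r) ger_powR// r0 ltW.
have sN : (0 < s ^+ k.+1 <= 1)%R by rewrite exprn_gt0// exprn_ile1// ltW.
apply: (@le_trans _ _ (((1 + C) / s ^+ k.+1) `^ p)%R).
  case/andP: sN => sN0 sN1.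
  rewrite ge0_ler_powR ?nnegrE ?addr_ge0 ?divr_ge0 ?addr_ge0// ?(ltW sN0)//.
  by rewrite mulrDl mul1r lerD2r invf_ge1.
rewrite powRM ?addr_ge0// ?invr_ge0 ?(ltW (andP sN).1)// ler_wpM2l ?powR_ge0//.
rewrite -powR_mulrn ?(ltW s0)// /s -powRrM -powRN -powRrM ger_powR//.
  by rewrite r0 ltW.
by rewrite mulNr lerN2 -?mulrA ?mulrA.
Qed.

End weight.

(** * The ring inequality for the maps [g_m] *)

Section ring_property.
Context {R : realType}.
Local Open Scope ereal_scope.

Lemma modulus_set0 (n : nat) : modulus (set0 : set (R -> 'rV[R]_n.+1)) <= 0.
Proof.
apply: ereal_inf_lbound; exists (fun=> 0); last first.
  rewrite (_ : (fun x : 'rV[R]_n.+1 => _) = (fun=> 0)) ?intRn0//.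
  by apply/funext => x; rewrite expeS mul0e.
split; last by split.
have := @Rn_borel_fun_shell R n.+1 0 0 0 (lexx _).
congr Rn_borel_fun; apply/funext => y; by case: ifP.
Qed.

Lemma ball_stretch_ring (k K m : nat) (C : R) (Q : 'rV[R]_k.+2 -> \bar R)
    (g := (K.+1%:R^-1 : R)%R) :
  (4 * (k.+2%:R * 4 ^+ k.+2) * (4 * k.+1%:R / g) ^+ k.+1 <= C)%R ->
  (forall x, x != 0%R -> (C / (enorm x `^ g) ^+ k.+1)%:E <= Q x) ->
  ring_Q_mapping Q (ball_stretch k.+2 K m).
Proof.
move=> HC HQ r1 r2 r10 r12 eta eta0 _ eta1.
have g0 : (0 < g)%R by rewrite invr_gt0.
have C0 : (0 <= C)%R.
  apply: le_trans HC; apply: mulr_ge0; first by rewrite mulr_ge0// mulr_ge0// exprn_ge0.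
  by rewrite exprn_ge0// divr_ge0 ?mulr_ge0 ?(ltW g0).
have I0 x : 0 <= (if x \in annulus r1 r2 `&` punct_ball
                  then Q x * eta (enorm x) ^+ k.+2 else 0).
  case: ifPn => //; rewrite inE => -[Hx [_ x0]].
  apply: mule_ge0; last by apply: expe_ge0; exact: eta0.
  by apply: le_trans (HQ _ x0); rewrite lee_fin divr_ge0// exprn_ge0// powR_ge0.
(* When [r2 >= 1] the outer sphere misses the open ball, so no curve is mapped and the modulus
   vanishes. *)
have [r21|r21] := leP 1%R r2.
  apply: (@le_trans _ _ 0); last exact: intRn_ge0.
  rewrite (_ : image_family _ _ = set0); first exact: modulus_set0.
  apply/seteqP; split => // f [gam [[_ [_ [gam1 _]]] inb] _].
  have [] := inb 1%R; first by rewrite ler01 lexx.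
  by rewrite /sphere /= in gam1; rewrite gam1 ltNge r21.
pose s1 := (r1 `^ g)%R; pose s2 := (r2 `^ g)%R.
have r20 : (0 < r2)%R by exact: lt_trans r12.
have s12 : (s1 < s2)%R by rewrite gt0_ltr_powR// nnegrE ltW.
have s10 : (0 < s1)%R by exact: powR_gt0.
have s21 : (s2 <= 1)%R.
  by rewrite -(powRr0 r2) ger_powR ?r20 ?(ltW r21)// ltW.
pose t1 := stretch m s1; pose t2 := stretch m s2.
have t10 : (0 < t1)%R by exact: stretch_gt0.
have st : (s2 - s1 <= t2 - t1)%R by exact: stretch_ge (ltW s12).
have t12 : (t1 < t2)%R by lra.
(* The branch [1 + s] keeps every image in the cube of sup norm at most [2], uniformly in [m]. *)
have t22 : (t2 <= 2)%R.
  by rewrite /t2 /stretch ge_min; apply/orP; right; lra.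
apply: le_trans (ring_energy_ge k g C r1 r2 Q eta g0 C0 r10 r12 (ltW r21) _ eta0 eta1).
  apply: le_trans (modulus_shell_le _ _ _ _ t10 t12 t22 _ _) _.
  - move=> _ [gam [[_ [gam0 [gam1 _]]] inb] <-] /=.
    rewrite !norm_ball_stretch; first by rewrite gam0 gam1.
    + by have [] := inb 1%R; rewrite ?ler01 ?lexx.
    + by have [] := inb 0%R; rewrite ?ler01 ?lexx.
  - move=> _ [gam [[_ [gam0 [gam1 gamt]]] inb] <-] t t01 /=.
    rewrite norm_ball_stretch; last by have [] := inb t t01.
    have : (r1 <= enorm (gam t) <= r2)%R.
      case/andP: t01; rewrite le_eqVlt => /orP[/eqP <- _|t0].
        by rewrite gam0 lexx ltW.
      rewrite le_eqVlt => /orP[/eqP ->|t1']; first by rewrite gam1 lexx ltW.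
      by have /andP[h1 h2] := gamt t (introT andP (conj t0 t1')); rewrite !ltW.
    move=> /andP[h1 h2].
    have h3 : (s1 <= enorm (gam t) `^ g)%R.
      by rewrite ge0_ler_powR ?nnegrE ?enorm_ge0// ltW.
    have h4 : (enorm (gam t) `^ g <= s2)%R.
      by rewrite ge0_ler_powR ?nnegrE ?enorm_ge0// ltW.
    have := stretch_ge m _ _ h3; have := stretch_ge m _ _ h4.
    rewrite -/g /t1 /t2; lra.
  rewrite lee_fin -/s1 -/s2.
  have d0 : (0 < s2 - s1)%R by rewrite subr_gt0.
  apply: (@le_trans _ _ (k.+2%:R * 4 ^+ k.+2 / (s2 - s1) ^+ k.+1)%R).
    apply: ler_wpM2l; first by rewrite mulr_ge0// exprn_ge0.
    rewrite lef_pV2 ?posrE ?exprn_gt0 ?subr_gt0//.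
    by rewrite lerXn2r ?nnegrE ?(ltW d0)// (le_trans (ltW d0)).
  set E := (_ ^+ k.+1 / 4)%R.
  have E0 : (0 <= E)%R.
    by rewrite divr_ge0// exprn_ge0// divr_ge0 ?(ltW g0)// !mulr_ge0// ltW.
  (* The threshold for [C] is calibrated so that its product with [E] equals the modulus bound in
     [s2 - s1]; the leading [4] cancels the [1/4] in [E]. *)
  apply: le_trans (ler_wpM2r E0 HC).
  rewrite le_eqVlt; apply/orP; left; apply/eqP; rewrite /E.
  have e : (4 * k.+1%:R / g * (g / (4 * k.+1%:R * (s2 - s1))) = (s2 - s1)^-1)%R.
    by field; rewrite !gt_eqF ?ltr0n.
  by rewrite -exprVn -e exprMn; field.
by move=> x ex; apply: HQ; rewrite -enorm_gt0.
Qed.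

End ring_property.

Theorem theorem8 (R : realType) (n : nat) (p : R) :
  (2 <= n)%N -> 1 <= p ->
  exists (Q : 'rV[R]_n -> \bar R) (g : nat -> 'rV[R]_n -> 'rV[R]_n)
         (c : nat -> 'rV[R]_n),
    (forall t : R, Rn_lebesgue_measurable [set x | unit_ball x /\ (Q x < t%:E)%E]) /\
    (forall x, unit_ball x -> (1 <= Q x)%E) /\
    (intRn (fun x => if x \in unit_ball then (Q x `^ p)%E else 0%E) < +oo)%E /\
    (forall m, homeo_onto_image punct_ball (g m)) /\
    (forall m, ring_Q_mapping Q (g m)) /\
    (forall m, cont_ext_at0 (g m) (c m)) /\
    ~ equicont_at0 g c.
Proof.
case: n => [|[|k]]// _ p1.
(* Here [n = k+2]. Since [K > 2 (k+1) p], the exponent [b = 1/(K+1)] satisfies [b (k+1) p <= 1/2],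
   as the integrability of [Q^p] requires. *)
pose K := Num.bound (2 * k.+1%:R * p); pose b : R := K.+1%:R^-1.
have b0 : 0 < b by rewrite invr_gt0.
pose C : R := 4 * (k.+2%:R * 4 ^+ k.+2) * (4 * k.+1%:R / b) ^+ k.+1.
have C0 : 0 <= C.
  apply: mulr_ge0; first by rewrite mulr_ge0// mulr_ge0// exprn_ge0.
  by rewrite exprn_ge0// divr_ge0 ?mulr_ge0 ?(ltW b0).
exists (ring_weight k b C), (ball_stretch k.+2 K), (fun=> 0).
split; first by move=> t; exact: ring_weight_measurable.
split; first by move=> x _; exact: ring_weight_ge1.
split.
  apply: ring_weight_Lp => //; first exact: ltW.
  have := @archi_boundP R (2 * k.+1%:R * p).
  rewrite -/K => /(_ _)/wrap[]; first by rewrite !mulr_ge0// (le_trans _ p1).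
  move=> H; rewrite -mulrA mulrC ler_pdivrMr// -natr1.
  lra.
split; first by move=> m; exact: ball_stretch_homeo.
split.
  move=> m; apply: (ball_stretch_ring _ _ _ C) => // x x0.
  by rewrite /ring_weight (negbTE x0) lee_fin lerDr.
split; first by move=> m; exact: ball_stretch_cont_ext.
exact: ball_stretch_not_equicont.
Qed.
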